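(* Let $F\in\mathbf F$ satisfy condition $\mathbf{H\mathcal A}$ and the integrability condition (I). Then $\mathcal D(F)\neq\emptyset$ implies $\mathbf{NA^w}$. If moreover $\mathbf{HN^0}$ and $\mathbf{KP}$ hold, then $\mathbf{NA^w}$ implies $\mathcal D(F)\neq\emptyset$.
   Context: Fix $T\in\mathbb N$, $\mathbb T=\{0,\dots,T\}$, $d\ge1$, a complete probability space $(\Omega,\mathcal F,\mathbb P)$ and a filtration $\mathbb H=(\mathcal H_t)_{t\in\mathbb T}$ with $\mathcal H_T\subset\mathcal F$ (no other relation between $\mathbb H$ and the other processes is assumed). Equalities and inequalities between random variables are understood $\mathbb P$-a.s. $\mathbb M^d$ denotes the real $d\times d$ matrices, $\mathbb M^d_+$ those with nonnegative entries, and $e_{ij}$ the matrix whose $(i,j)$ entry is $1$ and all other entries $0$. For $E\subset\mathbb M^d$ (or $E\subset\mathbb R^d$) and a $\sigma$-algebra $\mathcal G\subset\mathcal F$, $L^0(E;\mathcal G)$ is the set of $E$-valued $\mathcal G$-measurable random variables; $L^1(\mathbb R^d;\mathcal F)$ and $L^\infty(\mathbb R^d;\mathcal F)$ are the integrable, resp. bounded, elements of $L^0(\mathbb R^d;\mathcal F)$. A closed convex cone $\mathcal A\subset\mathbb M^d$ is fixed; $\mathbb L^0(\mathcal A;\mathbb H)$ denotes the set of $\mathcal A$-valued $\mathbb H$-adapted processes $(\eta_t)_{t\in\mathbb T}$. $\mathbb F$ is the set of continuous maps $f:\mathbb M^d\to\mathbb R^d$ such that (HF1) $f(\lambda a)=\lambda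 f(a)$ for all $\lambda\ge0$, $a\in\mathbb M^d$; (HF2) $f(\lambda a+\beta a')-(\lambda f(a)+\beta f(a'))\in\mathbb R^d_+$ for all $\lambda,\beta\ge0$, $a,a'\in\mathcal A$. $\mathbf F$ is the set of sequences $F=(F_t)_{t\in\mathbb T}$ of $\mathcal F$-measurable random maps $F_t:\Omega\times\mathbb M^d\to\mathbb R^d$ with $F_t(\omega,\cdot)\in\mathbb F$ for a.e. $\omega$ (no adaptedness to $\mathbb H$ is assumed); for a random matrix $\eta$, $F_t(\eta)(\omega)=F_t(\omega,\eta(\omega))$. $N_t(F)=\{F_t(\eta):\eta\in L^0(\mathcal A;\mathcal H_t)\}$, $N^0_t(F)=N_t(F)\cap(-N_t(F))$. For a process $\xi=(\xi_t)_{t\in\mathbb T}$, ''$\xi\in N(F)$'' means $\xi_t\in N_t(F)$ for all $t$, and ''$\xi\in N^0(F)$'' means $\xi_t\in N^0_t(F)$ for all $t$. $V_t(\xi)=\sum_{s=0}^t\xi_s$ and $A_t(F)=\{V_t(\xi)-r:\ \xi\in N(F),\ r\in L^0(\mathbb R^d_+;\mathcal F)\}$. Condition $\mathbf{KP}$: for all $\xi,\tilde\xi\in N(F)$, $V_T(\xi)+V_T(\tilde\xi)\in L^0(\mathbb R^d_+;\mathcal F)$ implies $\xi\in N^0(F)$ and $V_T(\xi)+V_T(\tilde\xi)=0$. Condition $\mathbf{HN^0}$: for all $t\in\mathbb T$ and $\eta\in L^0(\mathcal A;\mathcal H_t)$, $F_t(\eta)\in N^0_t(F)$ implies $F_t(-\eta)=-F_t(\eta)$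 and $-\eta\in L^0(\mathcal A;\mathcal H_t)$. Condition $\mathbf{H\mathcal A}$: for every $t\in\mathbb T$: (1) $F_t(\delta e_{ij})=0$ whenever $\delta e_{ij}\notin\mathcal A$, $\delta\in\{-1,1\}$, $i,j\le d$; (2) for every $\eta\in L^0(\mathbb M^d;\mathcal F)$, $F_t(\eta)=\sum_{i,j\le d}(\eta^{ij})^+F_t(e_{ij})+(\eta^{ij})^-F_t(-e_{ij})$. Condition (I): $F_t(e_{ij}),F_t(-e_{ij})\in L^1(\mathbb R^d;\mathcal F)$ for all $i,j\le d$, $t\in\mathbb T$. Condition $\mathbf{NA^w}$: $A_T(F)\cap L^0(\mathbb R^d_+;\mathcal F)=\{0\}$. For $Z\in L^\infty(\mathbb R^d;\mathcal F)$ and $\eta\in L^0(\mathcal A;\mathcal H_t)$, $\bar F_t(\eta;Z):=\mathbb E[Z\cdot F_t(\eta)\mid\mathcal H_t]$, which under $\mathbf{H\mathcal A}$ and (I) is understood as $\sum_{i,j}(\eta^{ij})^+\mathbb E[Z\cdot F_t(e_{ij})\mid\mathcal H_t]+(\eta^{ij})^-\mathbb E[Z\cdot F_t(-e_{ij})\mid\mathcal H_t]$ ($\cdot$ is the scalar product of $\mathbb R^d$). $\mathcal D(F)$ is the set of $Z\in L^\infty(\mathbb R^d;\mathcal F)$ with $Z^i>0$ a.s. for all $i\le d$ such that for all $\eta\in\mathbb L^0(\mathcal A;\mathbb H)$ and $t\in\mathbb T$: (D1) $\bar F_t(\eta_t;Z)\le0$; (D2) $F_t(\eta_t)\mathbf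 1_{\{\bar F_t(\eta_t;Z)=0\}}\in N^0_t(F)$. *)

(* Defs.v *)
From HB Require Import structures.
From mathcomp Require Import all_boot all_order all_algebra.
From mathcomp Require Import all_classical all_reals all_analysis.
Set Implicit Arguments. Unset Strict Implicit. Unset Printing Implicit Defensive.
Import Order.TTheory GRing.Theory Num.Theory.
Import numFieldNormedType.Exports.
Local Open Scope classical_set_scope.
Local Open Scope ring_scope.

Section Defs.
Context {R : realType} {dd : measure_display} {Omega : measurableType dd}.
Variable (P : probability Omega R).

Definition Gmeas (G : set (set Omega)) (f : Omega -> R) : Prop :=
  forall B : set R, measurable B -> G (f @^-1` B).

Definition Gmeas_vec {n : nat} (G : set (set Omega)) (X : Omega -> 'rV[R]_n) :=
  forall k : 'I_n, Gmeas G (fun w => X w 0 k).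
Definition Gmeas_mx {n : nat} (G : set (set Omega)) (X : Omega -> 'M[R]_n) :=
  forall i j : 'I_n, Gmeas G (fun w => X w i j).

Definition aeq {n : nat} (X Y : Omega -> 'rV[R]_n) := {ae P, forall w, X w = Y w}.
Definition nonneg_vec {n : nat} (v : 'rV[R]_n) := forall k : 'I_n, 0 <= v 0 k.

Definition is_cexp (G : set (set Omega)) (X Y : Omega -> R) : Prop :=
  [/\ Gmeas G Y, P.-integrable setT (EFin \o Y) &
      forall A, G A -> (\int[P]_(w in A) (Y w)%:E = \int[P]_(w in A) (X w)%:E)%E].

Definition cexp (G : set (set Omega)) (X : Omega -> R) : Omega -> R :=
  match pselect (exists Y, is_cexp G X Y) with
  | left h => proj1_sig (cid h)
  | right _ => fun _ => 0
  end.

Definition dotv {n : nat} (u v : 'rV[R]_n) : R := \sum_(k < n) u 0 k * v 0 k.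

Variables (T n : nat) (H : nat -> set (set Omega)) (Acone : set 'M[R]_n)
  (F : nat -> Omega -> 'M[R]_n -> 'rV[R]_n).

Definition Fapp (t : nat) (eta : Omega -> 'M[R]_n) : Omega -> 'rV[R]_n :=
  fun w => F t w (eta w).

Definition L0A (t : nat) (eta : Omega -> 'M[R]_n) : Prop :=
  exists eta', [/\ Gmeas_mx (H t) eta', (forall w, Acone (eta' w)) &
                   {ae P, forall w, eta w = eta' w}].

Definition inN (t : nat) (xi : Omega -> 'rV[R]_n) : Prop :=
  exists eta, L0A t eta /\ aeq xi (Fapp t eta).
Definition inN0 (t : nat) (xi : Omega -> 'rV[R]_n) : Prop :=
  inN t xi /\ inN t (fun w => - xi w).

Definition inNproc (xi : nat -> Omega -> 'rV[R]_n) := forall t, (t <= T)%N -> inN t (xi t).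
Definition inN0proc (xi : nat -> Omega -> 'rV[R]_n) := forall t, (t <= T)%N -> inN0 t (xi t).

Definition VT (xi : nat -> Omega -> 'rV[R]_n) : Omega -> 'rV[R]_n :=
  fun w => \sum_(t < T.+1) xi t w.

Definition inL0plus (X : Omega -> 'rV[R]_n) : Prop :=
  exists X', [/\ Gmeas_vec measurable X', (forall w, nonneg_vec (X' w)) & aeq X X'].

Definition inAT (X : Omega -> 'rV[R]_n) : Prop :=
  exists xi r, [/\ inNproc xi, inL0plus r & aeq X (fun w => VT xi w - r w)].

Definition KP : Prop :=
  forall xi xi', inNproc xi -> inNproc xi' ->
    inL0plus (fun w => VT xi w + VT xi' w) ->
    inN0proc xi /\ aeq (fun w => VT xi w + VT xi' w) (fun _ => 0).

Definition HN0 : Prop :=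
  forall t eta, (t <= T)%N -> L0A t eta -> inN0 t (Fapp t eta) ->
    aeq (Fapp t (fun w => - eta w)) (fun w => - Fapp t eta w) /\
    L0A t (fun w => - eta w).

Definition HA : Prop :=
  forall t, (t <= T)%N ->
  (forall (delta : R) (i j : 'I_n), (delta = 1 \/ delta = -1) ->
     ~ Acone (delta *: delta_mx i j) ->
     aeq (fun w => F t w (delta *: delta_mx i j)) (fun _ => 0)) /\
  (forall eta : Omega -> 'M[R]_n, Gmeas_mx measurable eta ->
     aeq (Fapp t eta)
       (fun w => \sum_(i < n) \sum_(j < n)
          (Num.max (eta w i j) 0 *: F t w (delta_mx i j) +
           Num.max (- eta w i j) 0 *: F t w (- delta_mx i j)))).

Definition condI : Prop :=
  forall t, (t <= T)%N -> forall (i j k : 'I_n),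
    P.-integrable setT (fun w => (F t w (delta_mx i j) 0 k)%:E) /\
    P.-integrable setT (fun w => (F t w (- delta_mx i j) 0 k)%:E).

Definition NAw : Prop :=
  (forall X, inAT X -> inL0plus X -> aeq X (fun _ => 0)) /\
  (inAT (fun _ => 0) /\ inL0plus (fun _ => 0)).

Definition barF (t : nat) (eta : Omega -> 'M[R]_n) (Z : Omega -> 'rV[R]_n) : Omega -> R :=
  fun w => \sum_(i < n) \sum_(j < n)
    (Num.max (eta w i j) 0 *
       cexp (H t) (fun w' => dotv (Z w') (F t w' (delta_mx i j))) w +
     Num.max (- eta w i j) 0 *
       cexp (H t) (fun w' => dotv (Z w') (F t w' (- delta_mx i j))) w).

Definition L0Aproc (eta : nat -> Omega -> 'M[R]_n) := forall t, (t <= T)%N -> L0A t (eta t).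

Definition inLinf (Z : Omega -> 'rV[R]_n) : Prop :=
  Gmeas_vec measurable Z /\ exists M : R, {ae P, forall w, forall k, `|Z w 0 k| <= M}.

Definition inD (Z : Omega -> 'rV[R]_n) : Prop :=
  [/\ inLinf Z, (forall k, {ae P, forall w, 0 < Z w 0 k}) &
   forall eta, L0Aproc eta -> forall t, (t <= T)%N ->
     {ae P, forall w, barF t (eta t) Z w <= 0} /\
     inN0 t (fun w => if barF t (eta t) Z w == 0 then F t w (eta t w) else 0)].

End Defs.

Definition inBoldF {R : realType} {dd : measure_display} {Omega : measurableType dd}
  (P : probability Omega R) (T n : nat) (Acone : set 'M[R]_n)
  (F : nat -> Omega -> 'M[R]_n -> 'rV[R]_n) : Prop :=
  forall t, (t <= T)%N ->
    (forall a : 'M[R]_n, Gmeas_vec measurable (fun w => F t w a)) /\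
    {ae P, forall w,
      [/\ continuous (F t w),
          (forall (l : R) a, 0 <= l -> F t w (l *: a) = l *: F t w a) &
          (forall (l b : R) a a', 0 <= l -> 0 <= b -> Acone a -> Acone a' ->
             nonneg_vec (F t w (l *: a + b *: a') - (l *: F t w a + b *: F t w a')))]}.

(* Main.v *)
Require Import Defs.
From HB Require Import structures.
From mathcomp Require Import all_boot all_order all_algebra.
From mathcomp Require Import all_classical all_reals all_analysis.
From mathcomp Require Import measurable_realfun.
From mathcomp Require Import ring lra.
Set Implicit Arguments. Unset Strict Implicit. Unset Printing Implicit Defensive.
Import Order.TTheory GRing.Theory Num.Theory.
Import numFieldNormedType.Exports.
Local Open Scope classical_set_scope.
Local Open Scope ring_scope.

(** Necessity of NA^w: if Z is in D(F) and Y_t = Z . F_t(eta_t), then the Y_t are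
    generalised supermartingale differences, although not adapted and not
    integrable; a backward induction on t shows that a nonnegative sum of such
    differences vanishes, and the positivity of Z transfers this to V_T.

    Existence of Z: by H_A the cone A_T(F) is generated by the finitely many
    random vectors F_t(+-e_ij) with coefficients in L^0_+(H_t). By KP and HN^0
    such a coefficient can only be compensated on the set where F_t(-e) = - F_t(e)
    and - e is in A, where it may be taken real. Each generator gets one extra
    coordinate recording its use outside this set. The enlarged cone is closed in
    L^0 (generators are added one at a time, from t = T down to t = 0) and meets
    L^0_+ only at 0. Instead of separating by Hahn-Banach, one minimises the
    expectation of a smooth convex decreasing loss with bounded derivative over
    this cone; minus the derivative at the minimiser is a bounded strictly
    positive dual variable. Its strict positivity on the extra coordinates is
    exactly what (D2) requires. *)

(** * A bounded reparametrisation of the half-line *)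

(** The vectors F_t(e) are only F-measurable and the coefficients are unbounded, so compactness has
    to come from the coefficients alone: hence [damp], under which +oo is an ordinary limit, and a
    Komlos lemma that uses midpoints only. The order in time is forced: adding a generator with
    H_t-measurable coefficients requires the cone already built to be stable under H_t-measurable
    factors, which holds when its own coefficients belong to later, larger sigma-algebras. The loss
    behaves like - x at -oo, so that Fatou controls the negative parts, and like 1 / x at +oo, where
    a minimising sequence may escape; the indicator of the escape set then lies in the cone, so this
    set is null. A derivative that is strictly positive by construction replaces the exhaustion
    argument which follows a Hahn-Banach separation. Elements of the cone need not be integrable, so
    the dual inequality is tested on generators times indicators only; this is enough to read off
    conditional expectations. *)

Section damp.
Context {R : realType}.
Implicit Types x y : R.

(* [damp] maps [0, +oo] homeomorphically onto [0, 1]: sequences of nonnegative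
   random variables that may diverge to +oo are handled through their images. *)
Definition damp x : R := (1 + Num.max x 0)^-1.

Lemma damp_max_gt0 x : 0 < 1 + Num.max x 0.
Proof. by rewrite ltr_pwDl// le_max lexx orbT. Qed.

Lemma damp_gt0 x : 0 < damp x.
Proof. by rewrite invr_gt0 damp_max_gt0. Qed.

Lemma damp_le1 x : damp x <= 1.
Proof. by rewrite invf_le1 ?damp_max_gt0// lerDl le_max lexx orbT. Qed.

Lemma dampE x : 0 <= x -> damp x = (1 + x)^-1.
Proof. by move=> x0; rewrite /damp; congr (1 + _)^-1; apply/max_idPl. Qed.

Lemma damp_mul x : 0 <= x -> damp x * x = 1 - damp x.
Proof. by move=> x0; rewrite dampE//; field; lra. Qed.

Lemma continuous_damp : continuous damp.
Proof.
move=> x; apply: (@cvgV _ _ _ _ (fun y => 1 + Num.max y 0)).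
  by rewrite gt_eqF ?damp_max_gt0.
apply: (@cvgD _ R^o); first exact: cvg_cst.
by apply: (@continuous_max _ _ id (cst 0)); [exact: cvg_id|exact: cvg_cst].
Qed.

Lemma measurable_damp : measurable_fun setT damp.
Proof. by apply: continuous_measurable_fun; exact: continuous_damp. Qed.

End damp.

(** * Random variables measurable for a sub-sigma-algebra *)

Section Gmeas_theory.
Context {R : realType} {dd : measure_display} {Omega : measurableType dd}.
Variables (G : set (set Omega)) (sG : sigma_algebra setT G).
Implicit Types f g : Omega -> R.

(** Makes [G] the sigma-algebra of a measurable type, so that the closure properties of measurable
    functions transfer to [Gmeas G]. *)
Lemma GmeasP f :
  Gmeas G f <-> measurable_fun setT (f : g_sigma_algebraType G -> R).
Proof.
split=> [Gf _ B mB|mf B mB]; first by rewrite setTI /measurable/= (sigma_algebra_id sG); exact: Gf.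
by have := mf measurableT B mB; rewrite setTI /measurable/= (sigma_algebra_id sG).
Qed.

Lemma GmeasE f : Gmeas measurable f <-> measurable_fun setT f.
Proof.
split=> [Gf _ B mB|mf B mB]; first by rewrite setTI; exact: Gf.
by have := mf measurableT B mB; rewrite setTI.
Qed.

Lemma Gmeas_cst r : Gmeas G (fun=> r : R).
Proof. by apply/GmeasP; exact: measurable_cst. Qed.

Lemma GmeasD f g : Gmeas G f -> Gmeas G g -> Gmeas G (fun w => f w + g w).
Proof. by move=> /GmeasP mf /GmeasP mg; apply/GmeasP; exact: measurable_funD. Qed.

Lemma GmeasB f g : Gmeas G f -> Gmeas G g -> Gmeas G (fun w => f w - g w).
Proof. by move=> /GmeasP mf /GmeasP mg; apply/GmeasP; exact: measurable_funB. Qed.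

Lemma GmeasM f g : Gmeas G f -> Gmeas G g -> Gmeas G (fun w => f w * g w).
Proof. by move=> /GmeasP mf /GmeasP mg; apply/GmeasP; exact: measurable_funM. Qed.

Lemma Gmeas_comp (h : R -> R) f : measurable_fun setT h -> Gmeas G f ->
  Gmeas G (fun w => h (f w)).
Proof. by move=> mh /GmeasP mf; apply/GmeasP; exact: measurableT_comp. Qed.

Lemma GmeasN f : Gmeas G f -> Gmeas G (fun w => - f w).
Proof. by move=> /GmeasP mf; apply/GmeasP; exact: measurable_funN. Qed.

Lemma Gmeas_max f g : Gmeas G f -> Gmeas G g -> Gmeas G (fun w => Num.max (f w) (g w)).
Proof. by move=> /GmeasP mf /GmeasP mg; apply/GmeasP; exact: measurable_maxr. Qed.

Lemma Gmeas_indic D : G D -> Gmeas G (\1_D : _ -> R).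
Proof.
move=> GD; apply/GmeasP; apply: measurable_indic.
by rewrite /measurable/= (sigma_algebra_id sG).
Qed.

Lemma Gmeas_sum I (r : seq I) (p : pred I) (f : I -> Omega -> R) :
  (forall i, p i -> Gmeas G (f i)) -> Gmeas G (fun w => \sum_(i <- r | p i) f i w).
Proof.
move=> mf; elim: r => [|i r ih].
  rewrite [X in Gmeas _ X](_ : _ = fun=> 0); first exact: Gmeas_cst.
  by apply/funext => w; rewrite big_nil.
rewrite [X in Gmeas _ X](_ : _ = fun w => (if p i then f i w else 0) +
    \sum_(i <- r | p i) f i w); last first.
  by apply/funext => w; rewrite big_cons; case: ifP; rewrite ?add0r.
by case: (boolP (p i)) => pi; apply: GmeasD => //; [exact: mf|exact: Gmeas_cst].
Qed.

Lemma Gmeas_prod (I : eqType) (r : seq I) (p : pred I) (f : I -> Omega -> R) :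
  (forall i, i \in r -> Gmeas G (f i)) -> Gmeas G (fun w => \prod_(i <- r | p i) f i w).
Proof.
elim: r => [|i r ih] mf.
  rewrite [X in Gmeas _ X](_ : _ = fun=> 1); first exact: Gmeas_cst.
  by apply/funext => w; rewrite big_nil.
rewrite [X in Gmeas _ X](_ : _ = fun w => (if p i then f i w else 1) *
    \prod_(i <- r | p i) f i w); last first.
  by apply/funext => w; rewrite big_cons; case: ifP; rewrite ?mul1r.
have mr : Gmeas G (fun w => \prod_(i <- r | p i) f i w).
  by apply: ih => j jr; apply: mf; rewrite inE jr orbT.
case: (boolP (p i)) => pi; apply: GmeasM => //; last exact: Gmeas_cst.
by apply: mf; rewrite inE eqxx.
Qed.

Lemma Gmeas_damp f : Gmeas G f -> Gmeas G (fun w => damp (f w)).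
Proof. by apply: Gmeas_comp; exact: measurable_damp. Qed.

Lemma Gmeas_set_lt f g : Gmeas G f -> Gmeas G g -> G [set w | f w < g w].
Proof.
move=> mf mg; have := GmeasB mf mg.
move=> /(_ `]-oo, 0[%classic); rewrite /preimage/= => /(_ (measurable_itv _)).
by congr G; apply/funext => w /=; rewrite in_itv/= subr_lt0.
Qed.

Lemma Gmeas_set_eq f r : Gmeas G f -> G [set w | f w = r].
Proof. by move=> mf; have := mf [set r] (measurable_set1 r). Qed.

Lemma GmeasC D : G D -> G (~` D).
Proof. by case: sG => _ + _ => /[apply]; rewrite setTD. Qed.

Lemma GmeasI D E : G D -> G E -> G (D `&` E).
Proof.
have GE : (measurable : set (set (g_sigma_algebraType G))) = G by exact: sigma_algebra_id.
by rewrite -GE; exact: measurableI.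
Qed.

Lemma GmeasT : G setT.
Proof. by rewrite -setC0; apply: GmeasC; case: sG. Qed.

End Gmeas_theory.

(** * Conditional expectation *)

Section sub_probability.
Context {R : realType} {dd : measure_display} {Omega : measurableType dd}.
Variables (P : probability Omega R) (G : set (set Omega)).
Hypotheses (sG : sigma_algebra setT G) (Gm : G `<=` measurable).
Local Open Scope ereal_scope.

(* The proofs are arguments so that the instances below can be inferred. *)
Definition restr_prob of sigma_algebra setT G & G `<=` measurable :
  set (g_sigma_algebraType G) -> \bar R := P.

Local Notation mu := (restr_prob sG Gm).

Lemma measurable_sub (A : set (g_sigma_algebraType G)) :
  measurable A -> measurable (A : set Omega).
Proof. by rewrite {1}/measurable/= (sigma_algebra_id sG) => /Gm. Qed.

Let mu0 : mu set0 = 0.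
Proof. exact: (measure0 P). Qed.

Let mu_ge0 A : 0 <= mu A.
Proof. exact: (measure_ge0 P). Qed.

Let mu_sigma : semi_sigma_additive mu.
Proof.
move=> F mF tF mUF; apply: (@measure_semi_sigma_additive _ _ _ P) => //.
- by move=> n; exact: measurable_sub.
- exact: measurable_sub.
Qed.

HB.instance Definition _ := isMeasure.Build _ _ _ mu mu0 mu_ge0 mu_sigma.

Let muT : mu setT = 1.
Proof. exact: probability_setT. Qed.

HB.instance Definition _ := Measure_isProbability.Build _ _ _ mu muT.

End sub_probability.

Section cexp_theory.
Context {R : realType} {dd : measure_display} {Omega : measurableType dd}.
Variables (P : probability Omega R).
Implicit Types X Y h : Omega -> R.
Import HBNNSimple.

Local Notation intg X := (P.-integrable setT (EFin \o X)).
Local Notation Ex X := (\int[P]_w (X w))%R.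

Lemma intg_meas X : intg X -> measurable_fun setT X.
Proof. by move=> /measurable_int /measurable_EFinP. Qed.

Lemma intgD X Y : intg X -> intg Y -> intg (fun w => X w + Y w).
Proof. by move=> iX iY; rewrite (_ : EFin \o _ = (EFin \o X) \+ (EFin \o Y))%E//; exact: integrableD. Qed.

Lemma intgB X Y : intg X -> intg Y -> intg (fun w => X w - Y w).
Proof. by move=> iX iY; rewrite (_ : EFin \o _ = (EFin \o X) \- (EFin \o Y))%E//; exact: integrableB. Qed.

Lemma intgM h X (M : R) : measurable_fun setT h -> (forall w, `|h w| <= M) -> intg X ->
  intg (fun w => h w * X w).
Proof.
move=> mh hM iX; apply: (@le_integrable _ _ _ P _ measurableT _ (fun w => M%:E * (X w)%:E)%E).
- apply/measurable_EFinP/measurable_funM => //; exact: intg_meas.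
- move=> w _ /=; rewrite lee_fin normrM normrM ler_wpM2r// (le_trans (hM w))//.
  exact: ler_norm.
- exact: integrableZl.
Qed.

Lemma intgZ r X : intg X -> intg (fun w => r * X w).
Proof. by move=> iX; apply: (@intgM (cst r) X `|r|). Qed.

Lemma intg_norm X : intg X -> intg (fun w => `|X w|).
Proof. by move=> iX; exact: integrable_norm. Qed.

Lemma intg_cst (r : R) : intg (fun=> r).
Proof. exact: finite_measure_integrable_cst. Qed.

Lemma intg_sum I (r : seq I) (p : pred I) (f : I -> Omega -> R) :
  (forall i, p i -> intg (f i)) -> intg (fun w => \sum_(i <- r | p i) f i w).
Proof.
move=> fi; elim: r => [|i r ih].
  rewrite [X in P.-integrable _ X](_ : _ = EFin \o cst 0) ?intg_cst//.
  by apply/funext => w /=; rewrite big_nil.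
rewrite (_ : EFin \o _ = EFin \o (fun w => (if p i then f i w else 0) +
    \sum_(i <- r | p i) f i w)); last first.
  by apply/funext => w /=; rewrite big_cons; case: ifP; rewrite ?add0r.
case: (boolP (p i)) => pi; apply: intgD => //; [exact: fi|exact: intg_cst].
Qed.

Lemma ExD X Y : intg X -> intg Y -> Ex (fun w => X w + Y w) = Ex X + Ex Y.
Proof. by move=> iX iY; rewrite RintegralD. Qed.

Lemma ExB X Y : intg X -> intg Y -> Ex (fun w => X w - Y w) = Ex X - Ex Y.
Proof. by move=> iX iY; rewrite RintegralB. Qed.

Lemma Ex_sum I (r : seq I) (p : pred I) (f : I -> Omega -> R) :
  (forall i, p i -> intg (f i)) ->
  Ex (fun w => \sum_(i <- r | p i) f i w) = \sum_(i <- r | p i) Ex (f i).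
Proof.
move=> fi; elim: r => [|i r ih].
  by rewrite big_nil; under eq_Rintegral do rewrite big_nil; rewrite Rintegral_cst// mul0r.
rewrite big_cons -ih.
under eq_Rintegral do rewrite big_cons.
case: ifPn => // pi; rewrite ExD//; [exact: fi|exact: intg_sum].
Qed.

Lemma Ex_ae_eq X Y : {ae P, forall w, X w = Y w} -> measurable_fun setT X ->
  measurable_fun setT Y -> Ex X = Ex Y.
Proof.
move=> XY mX mY; rewrite /Rintegral; congr fine; apply: ae_eq_integral => //.
- exact/measurable_EFinP.
- exact/measurable_EFinP.
- by apply: filterS XY => w /= ->.
Qed.

Lemma intg_ae_eq X Y : intg X -> measurable_fun setT Y ->
  {ae P, forall w, X w = Y w} -> intg Y.
Proof.
move=> iX mY XY; apply/integrableP; split; first exact/measurable_EFinP.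
rewrite (@ae_eq_integral _ _ _ P setT (abse \o (EFin \o X)))//.
- by case/integrableP : iX.
- exact/measurableT_comp/measurable_EFinP.
- by apply: measurableT_comp => //; exact: measurable_int iX.
- by apply: filterS XY => w /= ->.
Qed.

Lemma Ex_ae_ge0 X : measurable_fun setT X -> {ae P, forall w, 0 <= X w} -> 0 <= Ex X.
Proof.
move=> mX X0; rewrite (@Ex_ae_eq X (fun w => Num.max (X w) 0))//.
- by apply: Rintegral_ge0 => w _; rewrite le_max lexx orbT.
- by apply: filterS X0 => w X0; apply/esym/max_idPl.
- by apply: measurable_maxr.
Qed.

Lemma Ex_le X Y : intg X -> intg Y -> {ae P, forall w, X w <= Y w} -> Ex X <= Ex Y.
Proof.
move=> iX iY XY; rewrite -subr_ge0 -ExB//; apply: Ex_ae_ge0.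
  by apply: measurable_funB; exact: intg_meas.
by apply: filterS XY => w; rewrite subr_ge0.
Qed.

Lemma Ex_ae_eq0 X : intg X -> {ae P, forall w, 0 <= X w} -> Ex X <= 0 ->
  {ae P, forall w, X w = 0}.
Proof.
move=> iX X0 EX0.
have mX := intg_meas iX.
have EX : Ex X = 0 by apply/eqP; rewrite eq_le EX0 Ex_ae_ge0.
have : (\int[P]_w `|(X w)%:E| = 0)%E.
  rewrite (@ae_eq_integral _ _ _ P setT (EFin \o X))//.
  - by rewrite -(fineK (integrable_fin_num _ iX))//; congr EFin.
  - exact/measurableT_comp/measurable_EFinP.
  - exact/measurable_EFinP.
  - by apply: filterS X0 => w X0 _ /=; rewrite ger0_norm.
move/(@ae_eq_integral_abs _ _ _ P setT measurableT (EFin \o X)).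
move=> /(_ (measurable_int _ iX)); apply: filterS => w /(_ I).
by move=> [].
Qed.

Lemma Ex_indic D X : measurable D -> (\int[P]_(w in D) X w)%R = Ex (fun w => \1_D w * X w).
Proof.
move=> mD; rewrite Rintegral_mkcond; apply: eq_Rintegral => w _.
by rewrite patch_indic mulrC.
Qed.

Lemma intg_indic D X : measurable D -> intg X -> intg (fun w => \1_D w * X w).
Proof.
move=> mD iX; apply: (@intgM (\1_D) X 1) => //.
by move=> w; rewrite indicE; case: (_ \in _); rewrite ?normr1 ?normr0.
Qed.

Lemma Ex_dominated (f : nat -> Omega -> R) X g : (forall k, measurable_fun setT (f k)) ->
  measurable_fun setT X -> intg g ->
  (forall k, {ae P, forall w, `|f k w| <= g w}) ->
  {ae P, forall w, f k w @[k --> \oo] --> X w} ->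
  Ex (f k) @[k --> \oo] --> Ex X.
Proof.
move=> mf mX ig fg fX.
have [] := @dominated_convergence _ _ _ P setT measurableT
  (fun k => EFin \o f k) (EFin \o X) (EFin \o g).
- by move=> k; apply/measurable_EFinP.
- exact/measurable_EFinP.
- apply: filterS fX => w fX _.
  by apply: cvg_EFin; [exact: nearW|exact: fX].
- exact: ig.
- apply: filterS (ae_foralln fg).
  by move=> w H k _; rewrite lee_fin.
move=> iX _; rewrite -[X in _ --> X](@fineK _ (integral _ _ _)) ?integrable_fin_num//.
by move=> /fine_cvgP[].
Qed.

Variables (G : set (set Omega)) (sG : sigma_algebra setT G) (Gm : G `<=` measurable).

Lemma Gmeas_meas X : Gmeas G X -> measurable_fun setT X.
Proof. by move=> mX; apply/GmeasE => B mB; apply: Gm; exact: mX. Qed.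

Let TG := g_sigma_algebraType G.
Let mid : measurable_fun setT (id : Omega -> TG).
Proof.
by move=> _ B mB; rewrite setTI; exact: (measurable_sub sG Gm).
Qed.

(** The charge with density X, restricted to G by pushing it along the identity into [TG], is
    dominated by the restricted probability. Its Radon-Nikodym derivative is a witness, so the
    default 0 of [cexp] never occurs for integrable X. *)
Lemma cexpP X : intg X -> is_cexp P G X (cexp P G X).
Proof.
move=> iX; rewrite /cexp; case: pselect => [h|]; first by case: cid.
case.
pose mu : probability TG R := restr_prob P sG Gm.
pose nu : {charge set TG -> \bar R} :=
  measure_function_pushforward__canonical__charge_Charge (induced_charge iX) mid.
have numu : nu `<< mu.
  apply/null_content_dominatesP => A mA muA; rewrite /nu/= /pushforward/=.
  have mA' := measurable_sub sG Gm mA.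
  apply: (@null_set_integral _ _ _ P) => //.
  by apply: measurable_funTS; exact: measurable_int iX.
have fin w : (Radon_Nikodym nu mu) w \is a fin_num by exact: Radon_Nikodym_fin_num.
have imu := Radon_Nikodym_integrable numu.
have mf : measurable_fun setT ((Radon_Nikodym nu mu) : TG -> \bar R) := measurable_int _ imu.
have iP : P.-integrable setT ((Radon_Nikodym nu mu)).
  apply/integrableP; split; first by exact: (measurableT_comp mf mid).
  move/integrableP : imu => [_]; apply: le_lt_trans.
  rewrite -(@ge0_integral_pushforward _ _ _ _ _ _ mid P setT (abse \o (Radon_Nikodym nu mu)))//.
  - exact: measurableT_comp.
  - by move=> y _; exact: abse_ge0.
exists (fine \o (Radon_Nikodym nu mu)); split.
- apply/(GmeasP sG); exact: (measurableT_comp (fine_measurable _)).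
- by apply: eq_integrable iP => // w _ /=; rewrite fineK.
- move=> A GA.
  under eq_integral => w _ do rewrite fineK//.
  have mA : measurable (A : set TG) by rewrite /measurable/= (sigma_algebra_id sG).
  rewrite -[RHS]/(nu A) (Radon_Nikodym_integral numu)//.
  rewrite -[in LHS](@integral_pushforward _ _ _ _ _ _ mid P A)//.
  by apply: integrableS iP => //; exact: Gm.
Qed.

Lemma cexp_meas X : intg X -> Gmeas G (cexp P G X).
Proof. by case/cexpP. Qed.

Lemma cexp_intg X : intg X -> intg (cexp P G X).
Proof. by case/cexpP. Qed.

Lemma cexp_indic X A : intg X -> G A ->
  Ex (fun w => \1_A w * cexp P G X w) = Ex (fun w => \1_A w * X w).
Proof.
move=> /cexpP[_ _ H] GA; have mA := Gm GA.
by rewrite -!Ex_indic// /Rintegral H.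
Qed.

Lemma Ex_Gmeas_mul0 X h (M : R) : intg X ->
  (forall A, G A -> Ex (fun w => \1_A w * X w) = 0) ->
  Gmeas G h -> (forall w, 0 <= h w <= M) -> Ex (fun w => h w * X w) = 0.
Proof.
move=> iX X0 mh hM.
have mh' : measurable_fun (setT : set TG) (EFin \o (h : TG -> R)).
  by apply/measurable_EFinP/(GmeasP sG).
(* The approximation is taken in [TG], so the level sets of the simple functions lie in G and the
   hypothesis on indicators applies to them. *)
pose f := nnsfun_approx (@measurableT _ TG) mh'.
have f_cvg w : (f k : _ -> R) w @[k --> \oo] --> h w.
  have h0 (v : TG) : setT v -> (0 <= (EFin \o h) v)%E.
    by move=> _; rewrite lee_fin; have /andP[] := hM v.
  by have /fine_cvgP[] := cvg_nnsfun_approx (@measurableT _ TG) mh' h0 (x:=w) I.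
have f_le k w : (f k : _ -> R) w <= h w.
  have nd : nondecreasing_seq (fun k => (f k : _ -> R) w).
    by move=> a b ab; have /lefP := nd_nnsfun_approx (@measurableT _ TG) mh' ab; exact.
  rewrite -(cvg_lim _ (f_cvg w))//; apply: nondecreasing_cvgn_le => //.
  by apply/cvg_ex; eexists; exact: f_cvg.
have f0 k w : 0 <= (f k : _ -> R) w by [].
have mf k : measurable_fun setT (f k : Omega -> R).
  by apply: Gmeas_meas; apply/(GmeasP sG).
suff Ef k : Ex (fun w => (f k : _ -> R) w * X w) = 0.
  have : Ex (fun w => (f k : _ -> R) w * X w) @[k --> \oo] --> Ex (fun w => h w * X w).
    apply: (@Ex_dominated _ _ (fun w => M * `|X w|)).
    - by move=> k; apply: measurable_funM => //; exact: intg_meas.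
    - by apply: measurable_funM; [exact: Gmeas_meas|exact: intg_meas].
    - by apply: intgZ; exact: intg_norm.
    - move=> k; apply: aeW => w; rewrite normrM ler_wpM2r// ger0_norm//.
      by have /andP[_] := hM w; exact: le_trans.
    - by apply: aeW => w; apply: cvgM; [exact: f_cvg|exact: cvg_cst].
  by under eq_cvg do rewrite Ef; move/cvg_lim => <-//; rewrite lim_cst.
under eq_Rintegral do rewrite fimfunEord mulr_suml.
have mE i : G ((f k : _ -> R) @^-1` [set i]).
  suff : Gmeas G (f k : Omega -> R) by apply; exact: measurable_set1.
  exact/(GmeasP sG).
rewrite Ex_sum => [|i _]; last first.
  under eq_fun do rewrite -mulrA.
  by apply: intgZ; apply: intg_indic => //; exact: Gm.
rewrite big1// => i _.
under eq_Rintegral do rewrite -mulrA.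
rewrite RintegralZl//; first by rewrite X0 ?mulr0.
by apply: intg_indic => //; exact: Gm.
Qed.

Lemma cexp_mul X h (M : R) : intg X -> Gmeas G h -> (forall w, 0 <= h w <= M) ->
  Ex (fun w => h w * cexp P G X w) = Ex (fun w => h w * X w).
Proof.
move=> iX mh hM.
have mh' := Gmeas_meas mh.
have hM' w : `|h w| <= M by have /andP[h0 ?] := hM w; rewrite ger0_norm.
have iY := cexp_intg iX.
apply/eqP; rewrite -subr_eq0 -ExB; [|exact: intgM hM' _..].
under eq_Rintegral do rewrite -mulrBr; apply/eqP.
apply: (@Ex_Gmeas_mul0 (fun w => cexp P G X w - X w) h M) => //; first exact: intgB.
move=> A GA; have mA := Gm GA.
under eq_Rintegral do rewrite mulrBr.
by rewrite ExB ?cexp_indic ?subrr//; exact: intg_indic.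
Qed.

Lemma Gmeas_ae_le0 Y : Gmeas G Y -> intg Y ->
  (forall A, G A -> Ex (fun w => \1_A w * Y w) <= 0) -> {ae P, forall w, Y w <= 0}.
Proof.
move=> mY iY Y0; pose A := [set w | 0 < Y w].
have GA : G A by apply: Gmeas_set_lt => //; exact: Gmeas_cst.
have /Ex_ae_eq0 := Y0 _ GA.
move=> /(_ (intg_indic (Gm GA) iY)) /(_ _)/wrap[].
  apply: aeW => w; rewrite indicE; case: (boolP (w \in A)); last by rewrite mul0r.
  by rewrite inE mul1r => /ltW.
apply: filterS => w /eqP; rewrite mulf_eq0 => /orP[|/eqP->//].
rewrite indicE; case: (boolP (w \in A)); rewrite ?oner_eq0// => + _.
by rewrite notin_setE /A/= => /negP; rewrite -leNgt.
Qed.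

Lemma cexp_ge0 X : intg X -> (forall w, 0 <= X w) -> {ae P, forall w, 0 <= cexp P G X w}.
Proof.
move=> iX X0; have iY := cexp_intg iX.
have : {ae P, forall w, - cexp P G X w <= 0}.
  apply: Gmeas_ae_le0 => [||A GA]; first by apply: GmeasN => //; exact: cexp_meas.
    apply: intg_ae_eq (intgZ (-1) iY) _ _; first exact/measurable_funN/intg_meas.
    by apply: aeW => w; rewrite mulN1r.
  under eq_Rintegral do rewrite mulrN -mulN1r.
  rewrite RintegralZl//; last by apply: intg_indic => //; exact: Gm.
  rewrite cexp_indic// mulN1r oppr_le0; apply: Rintegral_ge0 => w _.
  by rewrite mulr_ge0// indicE.
by apply: filterS => w; rewrite oppr_le0.
Qed.

Lemma cexp_eq0_on X D : intg X -> (forall w, 0 <= X w) -> G D ->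
  {ae P, forall w, D w -> X w = 0} -> {ae P, forall w, D w -> cexp P G X w = 0}.
Proof.
move=> iX X0 GD XD; have iY := cexp_intg iX; have mD := Gm GD.
have Y0 : {ae P, forall w, 0 <= \1_D w * cexp P G X w}.
  by apply: filterS (cexp_ge0 iX X0) => w Y0; rewrite mulr_ge0// indicE.
have EY : Ex (fun w => \1_D w * cexp P G X w) <= 0.
  rewrite cexp_indic// (@Ex_ae_eq _ (fun=> 0))//.
  - by rewrite Rintegral_cst// mul0r.
  - apply: filterS XD => w XD; rewrite indicE.
    case: (boolP (w \in D)) => wD; last by rewrite mul0r.
    by rewrite XD ?mulr0//; rewrite inE in wD.
  - by apply: intg_meas; exact: intg_indic.
apply: filterS (Ex_ae_eq0 (intg_indic mD iY) Y0 EY) => w + Dw.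
by rewrite indicE mem_set// mul1r.
Qed.

End cexp_theory.

(** * A Komlos-type lemma *)

Section komlos.
Context {R : realType} {dd : measure_display} {Omega : measurableType dd}.
Variables (P : probability Omega R).
Local Notation intg X := (P.-integrable setT (EFin \o X)).
Local Notation Ex X := (\int[P]_w (X w))%R.

(** The increments are summable in L^1, so their series converges absolutely a.e. *)
Lemma ae_cvg_summable (u : nat -> Omega -> R) (C : R) :
  (forall k, intg (u k)) ->
  (forall k, Ex (fun w => `|u k.+1 w - u k w|) <= C / (2 ^ k.+1)%:R) ->
  {ae P, forall w, cvgn (u ^~ w)}.
Proof.
move=> iu uC.
pose d k w := `|u k.+1 w - u k w|.
have id k : intg (d k) by apply: intg_norm; exact: intgB.
have C0 : 0 <= C.
  have := le_trans _ (uC 0%N); rewrite -[X in X -> _]/(forall x, _) => /(_ 0).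
  by rewrite pmulr_lge0 ?invr_gt0//; apply; apply: Rintegral_ge0.
have md k : measurable_fun setT (EFin \o d k) by exact: measurable_int (id k).
have intS : P.-integrable setT (fun w => \sum_(0 <= k <oo) (d k w)%:E)%E.
  apply/integrableP; split.
    have := @ge0_emeasurable_sum _ _ R setT (fun k w => (d k w)%:E) xpredT.
    by apply=> [k w _ _|k _]; [rewrite lee_fin normr_ge0|exact: md].
  rewrite (eq_integral (fun w => \sum_(0 <= k <oo) (d k w)%:E)%E); last first.
    by move=> w _; rewrite gee0_abs//; apply: nneseries_ge0 => k _ _; rewrite lee_fin normr_ge0.
  rewrite integral_nneseries//; last by move=> k w _; rewrite lee_fin normr_ge0.
  apply: (@le_lt_trans _ _ C%:E); last exact: ltry.
  apply: le_trans (epsilon_trick0 xpredT C0).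
  apply: lee_nneseries => [k _ _|k _]; first by apply: integral_ge0 => w _; rewrite lee_fin normr_ge0.
  by rewrite -(fineK (integrable_fin_num _ (id k)))// lee_fin; exact: uC.
have := integrable_ae measurableT intS; apply: filterS => w /(_ I) fin.
have cd : cvgn (series (fun k => d k w)).
  apply: nondecreasing_is_cvgn.
    by apply: nondecreasing_series => n _ _; exact: normr_ge0.
  exists (fine (\sum_(0 <= k <oo) (d k w)%:E)) => _ [n _ <-].
  rewrite -lee_fin fineK// /series/= -sumEFin.
  by apply: (@nneseries_lim_ge _ (fun k => (d k w)%:E) xpredT) => k _ _; rewrite lee_fin normr_ge0.
have /normed_cvg cs : cvgn [normed series (telescope (u ^~ w))] by [].
have -> : u ^~ w = (fun n => u 0%N w + series (telescope (u ^~ w)) n).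
  by apply/funext => n; exact: (eq_sum_telescope (u ^~ w)).
apply: is_cvgD => //; exact: is_cvg_cst.
Qed.

(** With u = damp x and v = damp y, the midpoint is sent to the harmonic mean of u and v, and the
    right side equals (u - v)^2 * 2 / (u + v), where u + v <= 2. *)
Lemma damp_midpoint (x y : R) : 0 <= x -> 0 <= y ->
  (damp x - damp y) ^+ 2 <= 2 * (damp x + damp y) - 4 * damp ((x + y) / 2).
Proof.
move=> x0 y0; have [u0 u1] := (damp_gt0 x, damp_le1 x).
have [v0 v1] := (damp_gt0 y, damp_le1 y).
have -> : damp ((x + y) / 2) = 2 * damp x * damp y / (damp x + damp y).
  by rewrite !dampE ?divr_ge0 ?addr_ge0//; field; lra.
move: (damp x) (damp y) u0 u1 v0 v1 => u v u0 u1 v0 v1.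
have -> : 2 * (u + v) - 4 * (2 * u * v / (u + v)) = (u - v) ^+ 2 * (2 / (u + v)).
  by field; lra.
by rewrite ler_peMr ?sqr_ge0// ler_pdivlMr; lra.
Qed.

Lemma intg_damp X : measurable_fun setT X -> intg (fun w => damp (X w)).
Proof.
move=> mX; rewrite (_ : EFin \o _ = EFin \o (fun w => damp (X w) * 1)); last first.
  by apply/funext => w /=; rewrite mulr1.
apply: (@intgM _ _ _ _ (fun w => damp (X w)) (fun=> 1) 1); last exact: intg_cst.
- by apply: measurableT_comp mX; exact: measurable_damp.
- by move=> w; rewrite ger0_norm ?damp_le1// ltW// damp_gt0.
Qed.

Lemma intg_sqd X Y : measurable_fun setT X -> measurable_fun setT Y ->
  intg (fun w => (damp (X w) - damp (Y w)) ^+ 2).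
Proof.
move=> mX mY; rewrite (_ : EFin \o _ =
  EFin \o (fun w => (damp (X w) - damp (Y w)) * (damp (X w) - damp (Y w)))); last first.
  by apply/funext => w /=; rewrite expr2.
apply: (@intgM _ _ _ _ (fun w => damp (X w) - damp (Y w)) _ 1).
- by apply: measurable_funB; apply: measurableT_comp => //; exact: measurable_damp.
- move=> w; have := (damp_gt0 (X w), damp_le1 (X w), damp_gt0 (Y w), damp_le1 (Y w)).
  by move=> [[[? ?] ?] ?]; rewrite ler_norml; lra.
- by apply: intgB; exact: intg_damp.
Qed.

Section komlos_proof.
Variables (J : finType) (S : nat -> set (J -> Omega -> R)).
Hypotheses (S_dec : forall k, S k.+1 `<=` S k) (S_neq0 : forall k, S k !=set0)
  (S_meas : forall k X, S k X -> forall j, measurable_fun setT (X j))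
  (S_ge0 : forall k X, S k X -> forall j w, 0 <= X j w)
  (S_mid : forall k X Y, S k X -> S k Y -> S k (fun j w => (X j w + Y j w) / 2)).

Let val (X : J -> Omega -> R) := \sum_j Ex (fun w => damp (X j w)).
Let s k := inf (val @` S k).

Let val_ge0 X : 0 <= val X.
Proof. by apply: sumr_ge0 => j _; apply: Rintegral_ge0 => w _; rewrite ltW ?damp_gt0. Qed.

Let s_le k X : S k X -> s k <= val X.
Proof.
by move=> SX; apply: ge_inf; [exists 0 => _ [Y _ <-]|exists X].
Qed.

Let val_le k X : S k X -> val X <= #|J|%:R.
Proof.
move=> SX; rewrite -sum1_card natr_sum; apply: ler_sum => j _.
rewrite (_ : 1%:R = Ex (fun=> 1)); last first.
  by rewrite Rintegral_cst// [X in fine X](_ : _ = 1%E) ?mulr1//; exact: probability_setT.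
apply: Ex_le; [exact/intg_damp/(S_meas SX)|exact: intg_cst|].
by apply: aeW => w; exact: damp_le1.
Qed.

Let S_mono k l : (k <= l)%N -> S l `<=` S k.
Proof.
by move=> /subnK <-; elim: (l - k)%N => // i ih; apply: subset_trans ih; rewrite addSn; exact: S_dec.
Qed.

Let has_inf_val k : has_inf (val @` S k).
Proof.
split; last by exists 0 => _ [Y _ <-].
by have [X SX] := S_neq0 k; exists (val X); exists X.
Qed.

Let s_ub k : s k <= #|J|%:R.
Proof. by have [X SX] := S_neq0 k; apply: le_trans (s_le SX) (val_le SX). Qed.

Let smax := sup (range s).

Let s_smax k : s k <= smax.
Proof. by apply: ub_le_sup; [exists #|J|%:R => _ [i _ <-]|exists k]. Qed.

(** The infima [s k] increase to [smax]: go far enough for [s k] to be almost [smax], then take an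
    almost minimiser there. The condition i <= k will place the chosen element in S i. *)
Let near_opt i : exists kX : nat * (J -> Omega -> R),
  [/\ (i <= kX.1)%N, S kX.1 kX.2, smax - (8 ^ i)%:R^-1 <= s kX.1 &
      val kX.2 <= smax + (8 ^ i)%:R^-1].
Proof.
have e0 : 0 < (8 ^ i)%:R^-1 :> R by rewrite invr_gt0 ltr0n expn_gt0.
have /(sup_adherent e0)[_ [k _ <-] sk] : has_sup (range s).
  by split; [exists (s 0%N), 0%N|exists #|J|%:R => _ [j _ <-]].
have sm := S_mono (leq_maxr i k).
have [_ [X SX <-] vX] := inf_adherent e0 (has_inf_val (maxn i k)).
exists (maxn i k, X); split => //=; first exact: leq_maxl.
  apply: (le_trans (ltW sk)); rewrite /s; apply: lb_le_inf; first by case: (has_inf_val (maxn i k)).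
  by move=> _ [Y SY <-]; apply: s_le; exact: sm.
by apply: (le_trans (ltW vX)); rewrite lerD2r; exact: s_smax.
Qed.

(* Near-minimisers of the sum of the E[damp (X j)] over S k form a Cauchy
   sequence in L^2 after applying damp, because damp is strictly convex in the
   sense of [damp_midpoint]. The limits of the g k may be infinite. *)
Lemma komlos : exists g : nat -> J -> Omega -> R,
  (forall k, S k (g k)) /\
  {ae P, forall w, forall j, cvgn (fun k => damp (g k j w))}.
Proof.
have [f Hf] := choice near_opt.
exists (fun k => (f k).2); split.
  by move=> k; have [kf Sf _ _] := Hf k; exact: S_mono Sf.
apply: filter_forall => j.
(* With e = 2^-i, the tolerance 8^-i = e^3 gives E[x^2] <= 8 e^3 for the increment x, hence E|x| <=
   e + 8 e^2 <= 9 e = 18 / 2^(i+1). *)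
apply: (@ae_cvg_summable (fun k w => damp ((f k).2 j w)) 18).
  by move=> k; have [_ Sf _ _] := Hf k; apply: intg_damp; exact: S_meas Sf _.
move=> i; have [_ SX sX vX] := Hf i; have [_ SY sY vY] := Hf i.+1.
move: SX sX vX SY sY vY; move: (f i) (f i.+1) => [k X] [l Y]/= SX sX vX SY sY vY.
pose e : R := (2 ^ i)%:R^-1.
have e0 : 0 < e by rewrite invr_gt0 ltr0n expn_gt0.
have e1 : e <= 1 by rewrite invf_le1 ?ltr0n ?expn_gt0// ler1n expn_gt0.
have E8 : (8 ^ i)%:R^-1 = e ^+ 3 :> R.
  by rewrite /e exprVn -natrX expnAC.
have E8' : (8 ^ i.+1)%:R^-1 <= e ^+ 3 :> R.
  by rewrite -E8 lef_pV2 ?posrE ?ltr0n ?expn_gt0// ler_nat leq_exp2l.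
pose M j w := (X j w + Y j w) / 2.
(* The midpoint lies in the larger of the two classes, whose infimum is [s k] or [s l] and so is
   still within e^3 of [smax]. *)
have [m SmM sm] : exists2 m, S m M & smax - e ^+ 3 <= s m.
  have SM : S (minn k l) M.
    by apply: S_mid; [exact: S_mono (geq_minl _ _) _ _|exact: S_mono (geq_minr _ _) _ _].
  exists (minn k l) => //; rewrite /minn; case: ifP => _; first by rewrite -E8.
  by apply: le_trans sY; rewrite lerD2l lerN2.
have sq : \sum_j Ex (fun w => (damp (X j w) - damp (Y j w)) ^+ 2) <= 8 * e ^+ 3.
  apply: (@le_trans _ _ (2 * (val X + val Y) - 4 * val M)).
    rewrite /val -big_split/= !mulr_sumr -sumrB; apply: ler_sum => j' _.
    have iX := intg_damp (S_meas SX j'); have iY := intg_damp (S_meas SY j').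
    have iM := intg_damp (S_meas SmM j').
    rewrite -ExD// -!RintegralZl//; last exact: intgD.
    rewrite -ExB; [|by apply: intgZ; exact: intgD|exact: intgZ].
    apply: Ex_le.
    - by apply: intg_sqd; [exact: S_meas SX _|exact: S_meas SY _].
    - by apply: intgB; apply: intgZ => //; exact: intgD.
    - by apply: aeW => w; apply: damp_midpoint; [exact: S_ge0 SX _ _|exact: S_ge0 SY _ _].
  have := s_le SmM; rewrite E8 in vX; lra.
have sqj : Ex (fun w => (damp (X j w) - damp (Y j w)) ^+ 2) <= 8 * e ^+ 3.
  apply: le_trans sq; rewrite (bigD1 j)//= lerDl; apply: sumr_ge0 => j' _.
  by apply: Rintegral_ge0 => w _; exact: sqr_ge0.
(* The pointwise bound |x| <= e + x^2 / e stands in for the Cauchy-Schwarz inequality. *)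
apply: (@le_trans _ _ (e + e^-1 * Ex (fun w => (damp (X j w) - damp (Y j w)) ^+ 2))).
  have iXY := intg_sqd (S_meas SX j) (S_meas SY j).
  rewrite -RintegralZl// -{1}[e]mulr1 -[X in e * X](_ : fine (P setT) = _); last first.
    by rewrite [X in fine X](_ : _ = 1%E)//; exact: probability_setT.
  rewrite -(Rintegral_cst P measurableT e) -ExD; [|exact: intg_cst|exact: intgZ].
  apply: Ex_le.
  - apply/intg_norm/intgB; apply/intg_damp; [exact: S_meas SY _|exact: S_meas SX _].
  - by apply: intgD; [exact: intg_cst|exact: intgZ].
  - apply: aeW => w; rewrite distrC; move: (damp _ - damp _) => x.
    rewrite -(ler_pM2l e0) mulrDr mulrA divff ?gt_eqF// mul1r.
    rewrite -[x ^+ 2]real_normK ?num_real//; move: `|x| (normr_ge0 x) => y y0; nra.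
apply: (@le_trans _ _ (e + e^-1 * (8 * e ^+ 3))).
  by rewrite lerD2l ler_wpM2l// invr_ge0 ltW.
have -> : e^-1 * (8 * e ^+ 3) = 8 * e ^+ 2 by field; lra.
rewrite expnS natrM invfM -/e; nra.
Qed.

End komlos_proof.

End komlos.

(** * Closed convex cones of random vectors *)

Section limsup_real.
Context {R : realType}.
Implicit Types u : nat -> R.

Lemma cvgn_ge u (l a : R) : u k @[k --> \oo] --> l -> (forall k, a <= u k) -> a <= l.
Proof.
move=> ul au; rewrite -(cvg_lim _ ul)//; apply: limr_ge; last exact: nearW.
by apply/cvg_ex; exists l.
Qed.

Lemma cvgn_continuous (h : R -> R) u (l : R) : continuous h -> u k @[k --> \oo] --> l ->
  h (u k) @[k --> \oo] --> h l.
Proof. by move=> ch ul; apply: cvg_comp; [exact: ul|exact: ch]. Qed.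

(** Unlike the error itself, its tail supremum is nonincreasing, so the classes of approximants with
    this tolerance are nested, as [komlos] requires. *)
Lemma cvg_error_bound u (l : R) : u k @[k --> \oo] --> l ->
  [/\ forall k n, (k <= n)%N -> `|u n - l| <= sups (fun n => `|u n - l|) k,
      forall k, sups (fun n => `|u n - l|) k.+1 <= sups (fun n => `|u n - l|) k &
      sups (fun n => `|u n - l|) k @[k --> \oo] --> 0].
Proof.
move=> ul.
have dl : `|u n - l| @[n --> \oo] --> 0.
  rewrite -(@normr0 _ R) -(subrr l); apply: cvg_norm.
  by apply: cvgB; [exact: ul|exact: cvg_cst].
have ub : has_ubound (range (fun n => `|u n - l|)).
  by apply/bounded_fun_has_ubound/cvg_seq_bounded/cvg_ex; exists 0.
split; last exact: cvg_sups.
- by move=> k n kn; apply: ub_le_sup; [exact: has_ubound_sdrop|exists n].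
- by move=> k; apply: nonincreasing_sups.
Qed.

Lemma cvg_le_sups u (l : R) n : u k @[k --> \oo] --> l -> `|u n| <= sups (fun n => `|u n|) 0.
Proof.
move=> ul; apply: ub_le_sup; last by exists n.
apply/has_ubound_sdrop/bounded_fun_has_ubound/cvg_seq_bounded/cvg_ex; exists `|l|.
exact: cvg_norm.
Qed.

(** Inverse of [damp] on ]0, 1]. The value at 0, the image of +oo, is a default that is always
    masked by an indicator or met on a null set only. *)
Definition undamp (h : R) : R := Num.max (h `^ (- 1) - 1) 0.

Lemma undamp_cvg u h : (forall k, 0 <= u k) -> damp (u k) @[k --> \oo] --> h ->
  h != 0 -> u k @[k --> \oo] --> undamp h.
Proof.
move=> u0 uh h0.
have h1 : 0 <= h by apply: (cvgn_ge uh) => k; rewrite ltW// damp_gt0.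
have uE : u = (fun k => (damp (u k))^-1 - 1).
  by apply/funext => k; rewrite dampE// invrK; ring.
have uc : u k @[k --> \oo] --> h^-1 - 1.
  rewrite uE; apply: cvgB; last exact: cvg_cst.
  exact: cvgV.
rewrite /undamp powR_inv1//; have /max_idPl -> // : 0 <= h^-1 - 1.
by apply: (cvgn_ge uc).
Qed.

Lemma measurable_undamp : measurable_fun setT undamp.
Proof.
by apply: measurable_maxr => //; apply: measurable_funB => //; exact: measurable_powR.
Qed.

End limsup_real.

Section Gmeas_damp_lim.
Context {R : realType} {dd : measure_display} {Omega : measurableType dd}.
Variables (G : set (set Omega)) (sG : sigma_algebra setT G).

(** An upper limit is defined and G-measurable everywhere, although convergence holds only a.e. and
    G need not contain the null sets. *)
Definition damp_lim (c : nat -> Omega -> R) w : R := limn_sup (fun k => damp (c k w)).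

Lemma damp_lim_cvg c w : cvgn (fun k => damp (c k w)) ->
  damp (c k w) @[k --> \oo] --> damp_lim c w.
Proof.
by move=> /cvg_ex[l cl]; rewrite /damp_lim /limn_sup (cvg_lim _ (cvg_sups cl)).
Qed.

Lemma Gmeas_damp_lim (c : nat -> Omega -> R) : (forall k, Gmeas G (c k)) ->
  Gmeas G (damp_lim c).
Proof.
move=> mc; apply/(GmeasP sG).
apply: (@measurable_fun_limn_sup _ (g_sigma_algebraType G) R setT (fun k w => damp (c k w))).
- by move=> w _; exists 1 => _ [k _ <-]; exact: damp_le1.
- by move=> w _; exists 0 => _ [k _ <-]; rewrite ltW// damp_gt0.
- by move=> k; apply/(GmeasP sG); exact: Gmeas_damp.
Qed.

Lemma Gmeas_undamp (h : Omega -> R) : Gmeas G h -> Gmeas G (fun w => undamp (h w)).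
Proof. by apply: Gmeas_comp => //; exact: measurable_undamp. Qed.

End Gmeas_damp_lim.

(** * Closed cones of random vectors, and the addition of one generator *)

Section closed_cones.
Context {R : realType} {dd : measure_display} {Omega : measurableType dd}.
Variables (P : probability Omega R) (J : finType).
Implicit Types (X Y Z f : J -> Omega -> R) (G : set (set Omega)).

(** Closedness under a.e. limits is closedness in probability, by extraction of subsequences. The
    sigma-algebra G only limits the admissible factors: [cc_scale] is a stronger demand for a larger
    G. *)
Record ccone G (K : (J -> Omega -> R) -> Prop) := {
  cc_meas : forall X, K X -> forall j, measurable_fun setT (X j);
  cc_neg : forall X, (forall j, measurable_fun setT (X j)) ->
    (forall j, {ae P, forall w, X j w <= 0}) -> K X;
  cc_add : forall X Y, K X -> K Y -> K (fun j w => X j w + Y j w);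
  cc_scale : forall h X, Gmeas G h -> (forall w, 0 <= h w) -> K X ->
    K (fun j w => h w * X j w);
  cc_closed : forall (X : nat -> J -> Omega -> R) Y, (forall k, K (X k)) ->
    (forall j, measurable_fun setT (Y j)) ->
    (forall j, {ae P, forall w, X k j w @[k --> \oo] --> Y j w}) -> K Y }.

Lemma ccone_sub G G' K : G' `<=` G -> ccone G K -> ccone G' K.
Proof.
move=> GG' [Km Kn Ka Ks Kc]; split => // h X mh.
by apply: Ks => B mB; apply: GG'; exact: mh.
Qed.

Lemma cc_ae G K X Y : ccone G K -> K X -> (forall j, measurable_fun setT (Y j)) ->
  (forall j, {ae P, forall w, X j w = Y j w}) -> K Y.
Proof.
move=> cK KX mY XY.
by apply: (cc_closed cK) (fun=> KX) mY _ => j; apply: filterS (XY j) => w <-; exact: cvg_cst.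
Qed.

(** [B] is the event on which the generator is reversible: there it spans a line, elsewhere a
    half-line. *)
Definition gen_cone G (B : set Omega) f (K : (J -> Omega -> R) -> Prop) X :=
  exists mu k, [/\ Gmeas G mu, forall w, ~ B w -> 0 <= mu w, K k &
    X = fun j w => mu w * f j w + k j w].

Section gen_cone_closed.
Variables (G : set (set Omega)) (sG : sigma_algebra setT G) (Gm : G `<=` measurable).
Variables (K : (J -> Omega -> R) -> Prop) (cK : ccone G K).
Variables (B : set Omega) (f : J -> Omega -> R).
Hypothesis mf : forall j, measurable_fun setT (f j).
(** A coefficient escaping to +oo only yields - f in K, and one escaping to -oo only yields f. These
    two hypotheses supply the missing opposite; for the cones of the model they come from
    [gcone_opp]. *)
Hypothesis Kopp : forall D, G D ->
  K (fun j w => - \1_D w * f j w) -> K (fun j w => \1_D w * f j w).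
Hypothesis KoppB : forall D, G D -> D `<=` B ->
  K (fun j w => \1_D w * f j w) -> K (fun j w => - \1_D w * f j w).

Let mG (h : Omega -> R) : Gmeas G h -> measurable_fun setT h. Proof. exact: Gmeas_meas. Qed.

Let absorb D c : G D -> K (fun j w => \1_D w * f j w) -> K (fun j w => - \1_D w * f j w) ->
  Gmeas G c -> K (fun j w => c w * (\1_D w * f j w)).
Proof.
move=> GD K1 K2 mc.
have Kp := cc_scale cK (Gmeas_max sG mc (Gmeas_cst sG 0)) _ K1.
have Kn := cc_scale cK (Gmeas_max sG (GmeasN sG mc) (Gmeas_cst sG 0)) _ K2.
have := cc_add cK (Kp _) (Kn _).
set X := (X in _ -> _ -> K X) => KX.
have -> : (fun j w => c w * (\1_D w * f j w)) = X.
  apply/funext => j; apply/funext => w; rewrite /X.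
  have E : c w = Num.max (c w) 0 - Num.max (- c w) 0.
    by case: (leP 0 (c w)) => c0; case: (leP 0 (- c w)) => c0'; lra.
  by rewrite {1}E; ring.
by apply: KX => w; rewrite le_max lexx orbT.
Qed.

(** Only the coefficient is kept and the element of K is quantified away, since nothing is known
    about its convergence. The condition survives midpoints, so [komlos] can be applied to
    coefficients alone. *)
Let App (c : Omega -> R) Z (E : J -> Omega -> R) := exists2 k, K k &
  forall j, {ae P, forall w, `|c w * f j w + k j w - Z j w| <= E j w}.

Let App_mid c c' Z E : App c Z E -> App c' Z E -> App (fun w => (c w + c' w) / 2) Z E.
Proof.
move=> [k Kk H] [k' Kk' H'].
exists (fun j w => 2^-1 * (k j w + k' j w)).
  by apply: (cc_scale cK (Gmeas_cst sG 2^-1)) => //; exact: cc_add cK _ _ Kk Kk'.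
move=> j; apply: filterS2 (H j) (H' j) => w.
rewrite !ler_norml => /andP[? ?] /andP[? ?]; lra.
Qed.

(** Multiply by damp c: the bounded sum s c f + k tends to 0 where c tends to +oo, whereas damp c *
    c = 1 - damp c tends to 1. What remains is that damp c * k tends to - s f. *)
Let escape (c : nat -> Omega -> R) (s : R) (h : Omega -> R) (M : J -> Omega -> R) :
  (forall k, Gmeas G (c k)) -> (forall k w, 0 <= c k w) ->
  (forall k, App (fun w => s * c k w) (fun _ _ => 0) M) ->
  Gmeas G h -> {ae P, forall w, damp (c k w) @[k --> \oo] --> h w} ->
  K (fun j w => - s * (\1_[set w | h w = 0] w * f j w)).
Proof.
move=> mc c0 Ac mh ch; pose D := [set w | h w = 0].
have GD : G D by exact: Gmeas_set_eq.
have mD : measurable_fun setT (\1_D : _ -> R) by apply: mG; exact: Gmeas_indic.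
have [k Hk] := choice (fun n => let: ex_intro2 k Kk Hk := Ac n in ex_intro _ k (conj Kk Hk)).
apply: (cc_closed cK (X := fun n j w => (\1_D w * damp (c n w)) * k n j w)).
- move=> n; apply: (cc_scale cK); [|by move=> w; rewrite mulr_ge0// ltW// damp_gt0|by case: (Hk n)].
  by apply: GmeasM => //; [exact: Gmeas_indic|exact: Gmeas_damp].
- by move=> j; apply: measurable_funM => //; exact: measurable_funM.
move=> j; have Hj := ae_foralln (fun n => (Hk n).2 j).
apply: filterS2 ch Hj => w ch Hj; rewrite indicE.
case: (boolP (w \in D)) => [|_]; last first.
  by rewrite mul0r mulr0; under eq_fun do rewrite !mul0r; exact: cvg_cst.
rewrite inE /D/= => h0; rewrite h0 in ch.
have -> : (fun n => 1%:R * damp (c n w) * k n j w) = (fun n =>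
    damp (c n w) * (s * c n w * f j w + k n j w - 0) - s * ((1 - damp (c n w)) * f j w)).
  by apply/funext => n; rewrite -damp_mul//; ring.
rewrite (_ : - s * _ = 0 - s * ((1 - 0) * f j w)); last by ring.
apply: cvgB; last first.
  apply: cvgM; first exact: cvg_cst.
  by apply: cvgM; [apply: cvgB; [exact: cvg_cst|exact: ch]|exact: cvg_cst].
apply: norm_cvg0.
apply: (@squeeze_cvgr _ _ _ _ (fun=> 0) (fun n => damp (c n w) * M j w)).
- by apply: nearW => n; rewrite normr_ge0/= normrM ger0_norm ?ler_wpM2l// ltW// damp_gt0.
- exact: cvg_cst.
- by rewrite -(mul0r (M j w)); apply: cvgM; [exact: ch|exact: cvg_cst].
Qed.

Let gcl (X : nat -> J -> Omega -> R) Y : (forall k, gen_cone G B f K (X k)) ->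
  (forall j, measurable_fun setT (Y j)) ->
  (forall j, {ae P, forall w, X k j w @[k --> \oo] --> Y j w}) -> gen_cone G B f K Y.
Proof.
move=> KX mY XY.
have [mk Hmk] := choice (fun n => let: ex_intro mu (ex_intro k H) := KX n in
  ex_intro (fun p : (Omega -> R) * (J -> Omega -> R) =>
    [/\ Gmeas G p.1, forall w, ~ B w -> 0 <= p.1 w, K p.2 &
      X n = fun j w => p.1 w * f j w + p.2 j w]) (mu, k) H).
pose E k j w := sups (fun n => `|X n j w - Y j w|) k.
pose M j w := sups (fun n => `|X n j w|) 0%N.
(* The positive and negative parts of the coefficient are tracked separately because [komlos] wants
   nonnegative variables. Midpoints destroy their disjointness, so each part carries its own bound
   M, which [escape] will use. *)
pose S k (g : bool -> Omega -> R) := [/\ forall b, Gmeas G (g b),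
  forall b w, 0 <= g b w, forall w, ~ B w -> g false w = 0 &
  [/\ App (fun w => g true w - g false w) Y (E k),
     App (fun w => 1 * g true w) (fun _ _ => 0) M &
     App (fun w => - 1 * g false w) (fun _ _ => 0) M]].
have [|||||g [Sg cg]] := @komlos R dd Omega P bool S.
- move=> k g [? ? ? [[k1 Kk1 H1] ? ?]]; split => //; split => //; exists k1 => // j.
  apply: filterS2 (H1 j) (XY j) => w /le_trans H XYw; apply: H.
  by have [_ H _] := cvg_error_bound XYw; exact: H.
- move=> k; have [/= mmu mu0 Kk Xk] := Hmk k; set mu := (mk k).1 in mmu mu0 Xk; set ka := (mk k).2 in Kk Xk.
  exists (fun b w => if b then Num.max (mu w) 0 else Num.max (- mu w) 0); split.
  + by case; apply: Gmeas_max => //; [exact: Gmeas_cst|exact: GmeasN|exact: Gmeas_cst].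
  + by case=> w; rewrite le_max lexx orbT.
  + by move=> w Bw; apply/max_idPr; rewrite oppr_le0 mu0.
  split.
  + exists ka => // j; apply: filterS (XY j) => w XYw.
    have [H _ _] := cvg_error_bound XYw; apply: le_trans (H k k (leqnn k)).
    rewrite Xk -[X in _ <= `|X * _ + _ - _|](_ : Num.max (mu w) 0 - Num.max (- mu w) 0 = _)//.
    by case: (leP 0 (mu w)) => c0; case: (leP 0 (- mu w)) => c0'; lra.
  (* Cutting k to the event where mu is positive leaves X k there and 0 elsewhere. *)
  + exists (fun j w => \1_[set w | 0 < mu w] w * ka j w).
      apply: (cc_scale cK) => //; apply: Gmeas_indic => //.
      by apply: Gmeas_set_lt => //; exact: Gmeas_cst.
    move=> j; apply: filterS (XY j) => w XYw; have := cvg_le_sups k XYw.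
    apply: le_trans; rewrite Xk indicE subr0 mul1r.
    case: (boolP (w \in _)) => [|]; rewrite ?notin_setE ?inE/= => m0.
      by rewrite (max_idPl (ltW m0)) mul1r.
    have {}m0 : mu w <= 0 by rewrite leNgt; exact/negP.
    by rewrite (max_idPr m0) !mul0r addr0 normr0.
  + exists (fun j w => \1_[set w | mu w < 0] w * ka j w).
      apply: (cc_scale cK) => //; apply: Gmeas_indic => //.
      by apply: Gmeas_set_lt => //; exact: Gmeas_cst.
    move=> j; apply: filterS (XY j) => w XYw; have := cvg_le_sups k XYw.
    apply: le_trans; rewrite Xk indicE subr0 mulN1r.
    case: (boolP (w \in _)) => [|]; rewrite ?notin_setE ?inE/= => m0.
      have {}m0 : 0 <= - mu w by rewrite oppr_ge0 ltW.
      by rewrite (max_idPl m0) opprK mul1r.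
    have {}m0 : - mu w <= 0 by rewrite oppr_le0 leNgt; exact/negP.
    by rewrite (max_idPr m0) oppr0 !mul0r addr0 normr0.
- by move=> k g [mg _ _ _] b; exact: mG.
- by move=> k g [].
- move=> k g g' [mg ng gB [Ag1 Ag2 Ag3]] [mg' ng' gB' [Ag1' Ag2' Ag3']]; split.
  + by move=> b; apply: GmeasM => //; [exact: GmeasD|exact: Gmeas_cst].
  + by move=> b w; rewrite divr_ge0// addr_ge0.
  + by move=> w Bw; rewrite gB// gB'// addr0 mul0r.
  split.
  + have := App_mid Ag1 Ag1'; congr App; apply/funext => w; ring.
  + have := App_mid Ag2 Ag2'; congr App; apply/funext => w; ring.
  + have := App_mid Ag3 Ag3'; congr App; apply/funext => w; ring.
pose ha := damp_lim (g ^~ true); pose hb := damp_lim (g ^~ false).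
have mga b k : Gmeas G (g k b) by case: (Sg k).
have g0 b k w : 0 <= g k b w by case: (Sg k).
have gB k w : ~ B w -> g k false w = 0 by case: (Sg k) => _ _ + _; exact.
have mha : Gmeas G ha by apply: (Gmeas_damp_lim sG) => k; exact: mga.
have mhb : Gmeas G hb by apply: (Gmeas_damp_lim sG) => k; exact: mga.
pose Da := [set w | ha w = 0]; pose Db := [set w | hb w = 0].
have GDa : G Da by exact: Gmeas_set_eq.
have GDb : G Db by exact: Gmeas_set_eq.
have hbB w : ~ B w -> hb w = 1.
  move=> Bw; rewrite /hb /damp_lim; under eq_fun do rewrite gB// dampE// addr0 invr1.
  by rewrite /limn_sup (cvg_lim _ (cvg_sups (cvg_cst (1 : R^o))))//.
have Ka2 : K (fun j w => - \1_Da w * f j w).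
  have := @escape (g ^~ true) 1 ha M (mga true) (g0 true) _ mha.
  move=> /(_ (fun k => let: And4 _ _ _ (And3 _ H _) := Sg k in H)) /(_ _)/wrap[].
    by apply: filterS cg => w /(_ true); exact: damp_lim_cvg.
  by congr K; apply/funext => j; apply/funext => w; rewrite mulN1r mulNr.
have Kb1 : K (fun j w => \1_Db w * f j w).
  have := @escape (g ^~ false) (- 1) hb M (mga false) (g0 false) _ mhb.
  move=> /(_ (fun k => let: And4 _ _ _ (And3 _ _ H) := Sg k in H)) /(_ _)/wrap[].
    by apply: filterS cg => w /(_ false); exact: damp_lim_cvg.
  by congr K; apply/funext => j; apply/funext => w; rewrite opprK mul1r.
have Ka1 := Kopp GDa Ka2.
have Kb2 : K (fun j w => - \1_Db w * f j w).
  apply: KoppB => // w; rewrite /Db/= => hb0; apply: contrapT => /hbB.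
  by rewrite hb0 => /eqP; rewrite eq_sym oner_eq0.
pose D := Da `|` Db.
have GD : G D.
  rewrite /D -[Db]setCK -[Da]setCK -setCI; apply: GmeasC => //.
  rewrite (_ : _ `&` _ = [set w | 0 < ha w * ha w * (hb w * hb w)]).
    by apply: Gmeas_set_lt => //; [exact: Gmeas_cst|apply: GmeasM => //; exact: GmeasM].
  apply/seteqP; split => w /=; rewrite /Da /Db/=.
    by move=> [/eqP ha0 /eqP hb0]; rewrite mulr_gt0// -expr2 exprn_even_gt0//= ?ha0 ?hb0.
  move=> H; split=> h0; rewrite h0 ?(mul0r, mulr0) ltxx in H => //.
have Kabs c : Gmeas G c -> K (fun j w => c w * (\1_D w * f j w)).
  (* The second term is cut off Da, so that Da and Db are not counted twice. *)
  move=> mc; have Da1 := absorb GDa Ka1 Ka2 mc.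
  have mc' : Gmeas G (fun w => c w * \1_(~` Da) w).
    by apply: GmeasM => //; apply: Gmeas_indic => //; exact: GmeasC.
  have := cc_add cK Da1 (absorb GDb Kb1 Kb2 mc').
  congr K; apply/funext => j; apply/funext => w.
  rewrite !indicE in_setC /D in_setU.
  by case: (w \in Da); case: (w \in Db); rewrite /=; ring.
(* On D the whole line through f lies in K, so the coefficient may be set to 0; off D both parts
   converge to finite limits. *)
pose c w := (1 - \1_D w) * (undamp (ha w) - undamp (hb w)).
have mc : Gmeas G c.
  apply: GmeasM => //; last by apply: GmeasB => //; exact: (Gmeas_undamp sG).
  by apply: GmeasB => //; [exact: Gmeas_cst|exact: Gmeas_indic].
have [ka Hka] := choice (fun n => let: And4 _ _ _ (And3 (ex_intro2 k Kk H) _ _) := Sg n in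
  ex_intro _ k (conj Kk H)).
exists c, (fun j w => Y j w - c w * f j w); split => //.
- move=> w Bw; rewrite /c /undamp hbB// powR1 subrr maxxx subr0.
  by rewrite mulr_ge0 ?le_max ?lexx ?orbT//.
- apply: (cc_closed cK (X := fun n j w => ka n j w +
    (g n true w - g n false w) * (\1_D w * f j w))).
  + move=> n; apply: (cc_add cK); first by case: (Hka n).
    by apply: Kabs; apply: GmeasB => //; exact: mga.
  + by move=> j; apply: measurable_funB => //; apply: measurable_funM => //; exact: mG.
  move=> j; have Hj := ae_foralln (fun n => (Hka n).2 j).
  apply: filterS3 (XY j) cg Hj => w XYw cgw Hj.
  have -> : (fun n => ka n j w + (g n true w - g n false w) * (\1_D w * f j w)) =
      (fun n => ((g n true w - g n false w) * f j w + ka n j w) -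
        (1 - \1_D w) * (g n true w - g n false w) * f j w).
    by apply/funext => n; ring.
  apply: cvgB.
    rewrite -[Y j w]addr0; apply: (@cvg_trans _ ((fun n => Y j w +
        ((g n true w - g n false w) * f j w + ka n j w - Y j w)) @ \oo)).
      by apply: near_eq_cvg; apply: nearW => n; ring.
    apply: cvgD; first exact: cvg_cst.
    apply: norm_cvg0; have [_ _ E0] := cvg_error_bound XYw.
    apply: (squeeze_cvgr _ (cvg_cst 0) E0).
    by apply: nearW => n; rewrite normr_ge0/=; exact: Hj.
  apply: cvgM; last exact: cvg_cst.
  rewrite /c indicE; case: (boolP (w \in D)) => [_|].
    by rewrite subrr mul0r; under eq_fun do rewrite mul0r; exact: cvg_cst.
  rewrite notin_setE => nD; apply: cvgM; first exact: cvg_cst.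
  have cga : damp (g k true w) @[k --> \oo] --> ha w by exact: damp_lim_cvg.
  have cgb : damp (g k false w) @[k --> \oo] --> hb w by exact: damp_lim_cvg.
  apply: cvgB; apply: undamp_cvg => //; apply/eqP => h0; apply: nD; [by left|by right].
- by apply/funext => j; apply/funext => w; ring.
Qed.

(* Along a convergent sequence mu_k f + k_k, after convex combinations the
   coefficients converge in [-oo, +oo]. Where they diverge, normalising shows
   that f and - f both belong to K, so that the coefficient is irrelevant there. *)
Lemma gen_cone_ccone : ccone G (gen_cone G B f K).
Proof.
split.
- move=> _ [mu [k [mmu _ Kk ->]]] j; apply: measurable_funD; last exact: (cc_meas cK Kk j).
  by apply: measurable_funM => //; exact: mG.
- move=> X mX X0; exists (fun=> 0), X; split => //; first exact: Gmeas_cst.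
  + exact: (cc_neg cK mX X0).
  + by apply/funext => j; apply/funext => w; rewrite mul0r add0r.
- move=> _ _ [mu [k [mmu mu0 Kk ->]]] [mu' [k' [mmu' mu0' Kk' ->]]].
  exists (fun w => mu w + mu' w), (fun j w => k j w + k' j w); split => //.
  + exact: GmeasD.
  + by move=> w Bw; rewrite addr_ge0 ?mu0 ?mu0'.
  + exact: cc_add cK _ _ Kk Kk'.
  + by apply/funext => j; apply/funext => w; ring.
- move=> h _ mh h0 [mu [k [mmu mu0 Kk ->]]].
  exists (fun w => h w * mu w), (fun j w => h w * k j w); split => //.
  + exact: GmeasM.
  + by move=> w Bw; rewrite mulr_ge0 ?mu0.
  + exact: cc_scale cK _ _ mh h0 Kk.
  + by apply/funext => j; apply/funext => w; ring.
- exact: gcl.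
Qed.

End gen_cone_closed.
End closed_cones.

(** * Strictly positive dual variables by minimising a convex loss *)

Section loss.
Context {R : realType}.
Implicit Types x y z : R.

(* Convex, positive, decreasing, with bounded derivative - damp x ^+ 2, and
   dominating the negative part: minimising its expectation over a cone yields
   a bounded positive dual variable as a first-order condition. *)
Definition loss x : R := (1 + Num.max (- x) 0) * damp x.

Lemma loss_ge0 x : 0 <= loss x.
Proof. by rewrite mulr_ge0 ?ltW ?damp_gt0 ?damp_max_gt0. Qed.

Lemma loss_pos x : 0 <= x -> loss x = (1 + x)^-1.
Proof.
by move=> x0; rewrite /loss dampE// (max_idPr _) ?oppr_le0// addr0 mul1r.
Qed.

Lemma loss_neg x : x <= 0 -> loss x = 1 - x.
Proof.
move=> x0; rewrite /loss /damp (max_idPl _) ?oppr_ge0// (max_idPr _)//.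
by rewrite addr0 invr1 mulr1.
Qed.

Lemma damp_neg x : x <= 0 -> damp x = 1.
Proof. by move=> x0; rewrite /damp (max_idPr _)// addr0 invr1. Qed.

Lemma loss_ge_neg x : Num.max (- x) 0 <= loss x.
Proof.
have [x0|x0] := leP 0 x.
  by rewrite (max_idPr _) ?oppr_le0// loss_ge0.
by rewrite (max_idPl _) ?oppr_ge0 ?ltW// loss_neg ?ltW//; lra.
Qed.

(** The tangent inequality at z, where the derivative is - damp z ^+ 2. Convexity, the Lipschitz
    bound and the first-order condition are all read off it. *)
Lemma loss_subgrad x z : loss z - damp z ^+ 2 * (x - z) <= loss x.
Proof.
have [x0|x0] := leP 0 x; have [z0|z0] := leP 0 z.
- rewrite !loss_pos// dampE//.
  rewrite -subr_ge0 (_ : _ - _ = (x - z) ^+ 2 * ((1 + x)^-1 * ((1 + z)^-1) ^+ 2)).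
    by rewrite mulr_ge0 ?sqr_ge0// mulr_ge0 ?sqr_ge0// invr_ge0 addr_ge0.
  by field; lra.
- rewrite (loss_pos x0) (loss_neg (ltW z0)) (damp_neg (ltW z0)).
  rewrite -subr_ge0 (_ : _ - _ = x ^+ 2 * (1 + x)^-1); last by field; lra.
  by rewrite mulr_ge0 ?sqr_ge0// invr_ge0 addr_ge0.
- rewrite (loss_neg (ltW x0)) (loss_pos z0) dampE//.
  have v0 : 0 < (1 + z)^-1 by rewrite invr_gt0; lra.
  have v1 : (1 + z)^-1 <= 1 by rewrite invf_le1; lra.
  have zv : z * (1 + z)^-1 = 1 - (1 + z)^-1 by field; lra.
  move: ((1 + z)^-1) v0 v1 zv => v v0 v1 zv.
  have vz : v ^+ 2 * z = v - v ^+ 2 by rewrite expr2 -mulrA (mulrC v z) zv; ring.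
  have h1 : 0 <= - x * (1 - v ^+ 2).
    have v2 : v ^+ 2 <= 1 by rewrite expr2 mulr_ile1 // ltW.
    by apply: mulr_ge0; lra.
  have h2 := sqr_ge0 (1 - v).
  rewrite -subr_ge0 (_ : _ - _ = (1 - v) ^+ 2 + - x * (1 - v ^+ 2)) ?addr_ge0//.
  by rewrite mulrBr vz; ring.
- rewrite (loss_neg (ltW x0)) (loss_neg (ltW z0)) (damp_neg (ltW z0)); lra.
Qed.

Lemma loss_midpoint x y : loss ((x + y) / 2) <= (loss x + loss y) / 2.
Proof.
have := loss_subgrad x ((x + y) / 2); have := loss_subgrad y ((x + y) / 2).
move: (damp _ ^+ 2) => d; nra.
Qed.

Lemma loss_lip x y : loss (x + y) <= loss x + `|y|.
Proof.
have := loss_subgrad x (x + y).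
have d0 := damp_gt0 (x + y); have d1 := damp_le1 (x + y).
have e1 : damp (x + y) ^+ 2 <= 1 by rewrite expr2 mulr_ile1 // ltW.
have e0 : 0 <= damp (x + y) ^+ 2 by exact: sqr_ge0.
move: e0 e1; move: (damp (x + y) ^+ 2) => d e0 e1.
have := ler_norm y; have := normr_ge0 y; have := ler_norm (- y); rewrite normrN.
nra.
Qed.

Lemma continuous_loss : continuous loss.
Proof.
move=> x; apply: cvgM; last exact: continuous_damp.
apply: (@cvgD _ R^o); first exact: cvg_cst.
by apply: (@continuous_max _ _ -%R (cst 0)); [exact: opp_continuous|exact: cvg_cst].
Qed.

Lemma measurable_loss : measurable_fun setT loss.
Proof. by apply: continuous_measurable_fun; exact: continuous_loss. Qed.

End loss.

(** * Fatou's lemma for nonnegative sequences bounded in mean *)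

Section fatou.
Context {R : realType} {dd : measure_display} {Omega : measurableType dd}.
Variables (P : probability Omega R).
Local Notation intg X := (P.-integrable setT (EFin \o X)).
Local Notation Ex X := (\int[P]_w (X w))%R.
Variables (f : nat -> Omega -> R) (C : R).
Hypotheses (f_intg : forall k, intg (f k)) (f0 : forall k w, 0 <= f k w)
  (fC : forall k, Ex (f k) <= C).

Let L w := limn_einf (fun k => (f k w)%:E).

Let mf k : measurable_fun setT (fun w => (f k w)%:E).
Proof. exact: measurable_int (f_intg k). Qed.

Let mL : measurable_fun setT L.
Proof.
apply: (@emeasurable_fun_cvg _ _ _ setT (fun n w => einfs (fun k => (f k w)%:E) n)).
  by move=> n; exact: (measurable_fun_einfs mf).
by move=> w _; rewrite /L limn_einf_lim; exact: is_cvg_einfs.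
Qed.

Let L_ge0 w : (0 <= L w)%E.
Proof.
rewrite /L limn_einf_lim; apply: lime_ge; first exact: is_cvg_einfs.
apply: nearW => n; apply: le_ereal_inf_tmp => _ [k _ <-].
by rewrite lee_fin.
Qed.

Let L_le : (\int[P]_w L w <= C%:E)%E.
Proof.
apply: (le_trans (fatou P measurableT mf _)); first by move=> k w _; rewrite lee_fin.
rewrite limn_einf_lim; apply: lime_le; first exact: is_cvg_einfs.
apply: nearW => n; apply: (@le_trans _ _ (\int[P]_w (f n w)%:E)%E).
  by apply: ereal_inf_lbound; exists n => /=.
by rewrite -(fineK (integrable_fin_num _ (f_intg n)))// lee_fin; exact: fC.
Qed.

Let L_intg : P.-integrable setT L.
Proof.
apply/integrableP; split => //; under eq_integral do rewrite gee0_abs//.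
by apply: le_lt_trans L_le _; exact: ltry.
Qed.

Lemma fatou_cvg (X : Omega -> R) : measurable_fun setT X ->
  {ae P, forall w, f k w @[k --> \oo] --> X w} -> intg X /\ Ex X <= C.
Proof.
move=> mX fX.
have LX : {ae P, forall w, setT w -> L w = (X w)%:E}.
  apply: filterS fX => w fX _; apply: (cvg_limn_einf_sup _).1.
  by apply: cvg_EFin; [exact: nearW|exact: fX].
have mEX : measurable_fun setT (EFin \o X) by exact/measurable_EFinP.
have iX : intg X.
  apply/integrableP; split => //.
  rewrite (@ae_eq_integral _ _ _ P setT (abse \o L))//.
  - by case/integrableP : L_intg.
  - exact: measurableT_comp.
  - exact: measurableT_comp.
  - by apply: filterS LX => w /= + _ => ->.
split => //; rewrite -lee_fin fineK ?integrable_fin_num//.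
rewrite (@ae_eq_integral _ _ _ P setT L)//.
by apply: filterS LX => w + _ => ->.
Qed.

(** The lower limit is integrable, hence finite a.e., which excludes divergence to +oo. *)
Lemma fatou_damp : {ae P, forall w, ~ (damp (f k w) @[k --> \oo] --> (0 : R))}.
Proof.
have := integrable_ae measurableT L_intg; apply: filterS => w /(_ I) + d0.
suff -> : L w = +oo%E by [].
apply: (cvg_limn_einf_sup _).1; apply/cvgeryP.
have : (damp (f k w))^-1 @[k --> \oo] --> +oo.
  apply/(gtr0_cvgV0 (f := fun k => (damp (f k w))^-1)).
    by apply: nearW => k; rewrite invr_gt0 damp_gt0.
  by under eq_cvg do rewrite /= invrK.
move=> H; apply/cvgryPge => A; near=> k.
have : A + 1 <= (damp (f k w))^-1 by near: k; exact: cvgry_ge.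
by rewrite dampE// invrK; lra.
Unshelve. all: by end_near. Qed.

End fatou.

Lemma continuous_min_scale {R : realType} (c : R) : continuous (fun x => Num.min (c * x) 1).
Proof.
move=> x; apply: (@continuous_min _ _ ( *%R c) (cst 1)); last exact: cvg_cst.
exact: mulrl_continuous.
Qed.

(** * Minimisation of the total loss over a closed cone *)

Section kreps_yan.
Context {R : realType} {dd : measure_display} {Omega : measurableType dd}.
Variables (P : probability Omega R) (J : finType).
Local Notation intg X := (P.-integrable setT (EFin \o X)).
Local Notation Ex X := (\int[P]_w (X w))%R.
Variables (G : set (set Omega)) (sG : sigma_algebra setT G).
Variables (K : (J -> Omega -> R) -> Prop) (cK : ccone P G K).
Hypothesis K_na : forall X, K X -> (forall j, {ae P, forall w, 0 <= X j w}) ->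
  forall j, {ae P, forall w, X j w = 0}.

Let tloss (X : J -> Omega -> R) w := \sum_j loss (X j w).

Let tloss_ge0 X w : 0 <= tloss X w.
Proof. by apply: sumr_ge0 => j _; exact: loss_ge0. Qed.

Let meas_tloss (X : J -> Omega -> R) : (forall j, measurable_fun setT (X j)) -> measurable_fun setT (tloss X).
Proof.
move=> mX; apply/GmeasE; apply: (Gmeas_sum (sigma_algebra_measurable Omega)) => j _.
by apply/GmeasE; apply: measurableT_comp (mX j); exact: measurable_loss.
Qed.

Let K_down (X Y : J -> Omega -> R) : K X -> (forall j, measurable_fun setT (Y j)) ->
  (forall j w, Y j w <= X j w) -> K Y.
Proof.
move=> KX mY YX; have mX := cc_meas cK KX.
have := cc_add cK KX (cc_neg cK (X := fun j w => Y j w - X j w) _ _).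
rewrite (_ : (fun _ _ => X _ _ + _) = Y); last first.
  by apply/funext => j; apply/funext => w; ring.
apply; first by move=> j; exact: measurable_funB.
by move=> j; apply: aeW => w; rewrite subr_le0.
Qed.

Let K_pos X (c : R) : K X -> 0 <= c -> K (fun j w => c * X j w).
Proof. by move=> KX c0; exact: (cc_scale cK (Gmeas_cst sG c)). Qed.

Let K0 : K (fun _ _ => 0).
Proof. by apply: (cc_neg cK) => // j; exact: aeW. Qed.

Let Val := [set r | exists X, [/\ K X, intg (tloss X) & Ex (tloss X) = r]].
Let s := inf Val.

Let Val_inf : has_inf Val.
Proof.
split; last by exists 0 => _ [X [_ _ <-]]; apply: Rintegral_ge0 => w _; exact: tloss_ge0.
exists (Ex (tloss (fun _ _ => 0))), (fun _ _ => 0); split => //.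
by apply: intg_sum => j _; exact: intg_cst.
Qed.

Let s_le X : K X -> intg (tloss X) -> s <= Ex (tloss X).
Proof. by move=> KX iX; apply: ge_inf; [case: Val_inf|exists X]. Qed.

Let toX (g : J * bool -> Omega -> R) : J -> Omega -> R := fun j w => g (j, true) w - g (j, false) w.

(** Almost minimisers written as differences of nonnegative variables. The mean of the subtracted
    part is bounded because the loss dominates the negative part; no such bound exists for the other
    part. *)
Let S k (g : J * bool -> Omega -> R) := [/\ forall i, measurable_fun setT (g i),
  forall i w, 0 <= g i w, K (toX g),
  intg (tloss (toX g)) /\ Ex (tloss (toX g)) <= s + k.+1%:R^-1 &
  forall j, intg (g (j, false)) /\ Ex (g (j, false)) <= s + 1].

Let S_neq0 k : S k !=set0.
Proof.
have e0 : 0 < k.+1%:R^-1 :> R by rewrite invr_gt0.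
have [_ [X [KX iX <-]] /ltW Xs] := inf_adherent e0 Val_inf.
have mX := cc_meas cK KX.
pose g (i : J * bool) w := if i.2 then Num.max (X i.1 w) 0 else Num.max (- X i.1 w) 0.
have gX : toX g = X.
  apply/funext => j; apply/funext => w; rewrite /toX /g/=.
  by case: (leP 0 (X j w)) => c0; case: (leP 0 (- X j w)) => c0'; lra.
have mg i : measurable_fun setT (g i).
  case: i => j [] /=; first by apply: measurable_maxr.
  by apply: measurable_maxr => //; exact: measurable_funN.
exists g; rewrite /S gX; split => //.
  by move=> [j b] w; rewrite /g; case: ifP => _; rewrite le_max lexx orbT.
move=> j; have gle w : g (j, false) w <= tloss X w.
  rewrite /tloss (bigD1 j)//= (le_trans (loss_ge_neg (X j w)))// lerDl.
  by apply: sumr_ge0 => i _; exact: loss_ge0.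
have ig : intg (g (j, false)).
  apply: (le_integrable measurableT _ _ iX); first exact/measurable_EFinP.
  move=> w _ /=; rewrite lee_fin !ger0_norm//.
  by rewrite /g/= le_max lexx orbT.
split => //; apply: le_trans (le_trans Xs _); last first.
  by rewrite lerD2l invf_le1// ler1n.
by apply: Ex_le => //; exact: aeW.
Qed.

Let S_mid k g g' : S k g -> S k g' -> S k (fun i w => (g i w + g' i w) / 2).
Proof.
move=> [mg g0 Kg [ig sg] fg] [mg' g0' Kg' [ig' sg'] fg'].
have half0 : 0 <= 2^-1 :> R by [].
have mG i : measurable_fun setT (fun w => (g i w + g' i w) / 2).
  by apply: measurable_funM => //; exact: measurable_funD.
have E : toX (fun i w => (g i w + g' i w) / 2) = fun j w => 2^-1 * (toX g j w + toX g' j w).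
  by apply/funext => j; apply/funext => w; rewrite /toX; field.
have KM : K (toX (fun i w => (g i w + g' i w) / 2)).
  by rewrite E; apply: K_pos => //; exact: (cc_add cK).
have le_mid w : tloss (toX (fun i w => (g i w + g' i w) / 2)) w <=
    2^-1 * (tloss (toX g) w + tloss (toX g') w).
  rewrite E /tloss -big_split/= mulr_sumr; apply: ler_sum => j _.
  by rewrite mulrC [leRHS]mulrC; exact: loss_midpoint.
have iR : intg (fun w => 2^-1 * (tloss (toX g) w + tloss (toX g') w)).
  by apply: intgZ; exact: intgD.
have iM : intg (tloss (toX (fun i w => (g i w + g' i w) / 2))).
  apply: (le_integrable measurableT _ _ iR).
    by apply/measurable_EFinP/meas_tloss/(cc_meas cK).
  by move=> w _ /=; rewrite lee_fin !ger0_norm// mulr_ge0// addr_ge0.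
split => //.
- by move=> i w; rewrite divr_ge0// addr_ge0.
- split => //; apply: (le_trans (Ex_le iM iR (aeW _ le_mid))).
  rewrite RintegralZl//; last exact: intgD.
  rewrite ExD// mulrC ler_pdivrMr// mulr_natr mulr2n; exact: lerD.
- move=> j; have [i1 s1] := fg j; have [i2 s2] := fg' j.
  have iD : intg (fun w => 2^-1 * (g (j, false) w + g' (j, false) w)).
    by apply: intgZ; exact: intgD.
  rewrite (_ : (fun w => _ / 2) = (fun w => 2^-1 * (g (j, false) w + g' (j, false) w))); last first.
    by apply/funext => w; rewrite mulrC.
  split => //; rewrite RintegralZl//; last exact: intgD.
  by rewrite ExD// mulrC ler_pdivrMr// mulr_natr mulr2n lerD.
Qed.

(** The loss is not coercive at +oo. Negative parts stay finite by [fatou_damp]; where a positive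
    part diverges, dividing by n + 1 and truncating at 1 produces, in the limit, the indicator of
    the divergence set as an element of K, and [K_na] makes this set null. *)
Lemma minimizer : exists X, [/\ K X, intg (tloss X) & Ex (tloss X) <= s].
Proof.
have [|||||g [Sg cg]] := @komlos R dd Omega P _ S.
- move=> k g [? ? ? [? H] ?]; split => //; split => //; apply: (le_trans H).
  by rewrite lerD2l lef_pV2 ?posrE// ler_nat.
- exact: S_neq0.
- by move=> k g [].
- by move=> k g [].
- exact: S_mid.
pose h i := damp_lim (fun k => g k i).
have sM := sigma_algebra_measurable Omega.
have mg k i : measurable_fun setT (g k i) by case: (Sg k).
have g0 k i w : 0 <= g k i w by case: (Sg k).
have mh i : measurable_fun setT (h i).
  by apply/GmeasE/(Gmeas_damp_lim sM) => k; apply/GmeasE; exact: mg.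
have hcvg : {ae P, forall w, forall i, damp (g k i w) @[k --> \oo] --> h i w}.
  by apply: filterS cg => w cg i; exact: damp_lim_cvg.
have hf j : {ae P, forall w, h (j, false) w != 0}.
  have := @fatou_damp _ _ _ P (fun k => g k (j, false)) (s + 1).
  move=> /(_ _ _ _)/wrap[|||H].
  - by move=> k; case: (Sg k) => _ _ _ _ /(_ j)[].
  - by move=> k w.
  - by move=> k; case: (Sg k) => _ _ _ _ /(_ j)[].
  apply: filterS2 hcvg H => w hc nd; apply/eqP => h0; apply: nd.
  by rewrite -h0; exact: hc.
have fcvg j : {ae P, forall w, g k (j, false) w @[k --> \oo] --> undamp (h (j, false) w)}.
  by apply: filterS2 hcvg (hf j) => w hc hf0; apply: undamp_cvg.
have mu i : measurable_fun setT (fun w => undamp (h i w)).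
  by apply: measurableT_comp => //; exact: measurable_undamp.
pose X j w := undamp (h (j, true) w) - undamp (h (j, false) w).
have mX j : measurable_fun setT (X j) by exact: measurable_funB.
pose D j := [set w | h (j, true) w = 0].
have mD j : measurable (D j).
  by apply: (@Gmeas_set_eq R _ _ measurable) => //; exact/GmeasE.
have mI j : measurable_fun setT (\1_(D j) : _ -> R) by exact: measurable_indic.
(* The limit in k of the truncations at 1 of the k-th vector divided by n + 1; these lie in K by
   [K_down]. *)
pose Y n j w := \1_(D j) w + (1 - \1_(D j) w) * Num.min (n.+1%:R^-1 * X j w) 1.
have mY n j : measurable_fun setT (Y n j).
  apply: measurable_funD => //; apply: measurable_funM; first exact: measurable_funB.
  by apply: measurable_minr => //; exact: measurable_funM.
have KY n : K (Y n).
  apply: (cc_closed cK (X := fun k j w => Num.min (n.+1%:R^-1 * toX (g k) j w) 1)) => //.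
    move=> k; apply: (@K_down (fun j w => n.+1%:R^-1 * toX (g k) j w)).
    - by apply: K_pos; [case: (Sg k)|rewrite invr_ge0].
    - move=> j; apply: measurable_minr => //; apply: measurable_funM => //.
      by apply: measurable_funB.
    - by move=> j w; rewrite ge_min lexx.
  move=> j; apply: filterS2 hcvg (fcvg j) => w hc fc; rewrite /Y indicE.
  case: (boolP (w \in D j)); rewrite ?notin_setE ?inE /D/=.
    move=> h0; rewrite subrr mul0r addr0; apply: cvg_near_cst.
    pose m := undamp (h (j, false) w).
    have ht := hc (j, true); rewrite h0 in ht.
    (* Once the negative part is below m + 1 and the positive part above n + 1 + (m + 1), their
       difference exceeds n + 1 and the minimum is 1. *)
    have A0 : 0 <= n.+1%:R + (m + 1) by rewrite addr_ge0 ?addr_ge0// /m /undamp le_max lexx orbT.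
    near=> k; apply/min_idPr; rewrite ler_pdivlMl// mulr1 /toX lerBrDr.
    have fk : g k (j, false) w < m + 1.
      by near: k; apply: (cvgr_lt _ (fc : _ --> m)); rewrite ltrDl.
    have tk : damp (g k (j, true) w) < damp (n.+1%:R + (m + 1)).
      by near: k; apply: (cvgr_lt _ ht); exact: damp_gt0.
    move: tk; rewrite !dampE// ltf_pV2; [lra|by rewrite posrE ltr_pwDl..].
  move=> /eqP ht0; rewrite subr0 add0r mul1r.
  have tX : toX (g k) j w @[k --> \oo] --> X j w.
    apply: cvgB; last exact: fc.
    by apply: undamp_cvg => //; exact: (hc (j, true)).
  exact: (cvgn_continuous (@continuous_min_scale R n.+1%:R^-1) tX).
have K1 : K (fun j w => \1_(D j) w).
  apply: (cc_closed cK KY) => // j; apply: aeW => w; rewrite /Y.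
  rewrite -[X in _ --> X]addr0 -(mulr0 (1 - \1_(D j) w)).
  apply: cvgD; first exact: cvg_cst.
  apply: cvgM; first exact: cvg_cst.
  rewrite -[X in _ --> X](_ : Num.min (X j w * 0) 1 = _); last by rewrite mulr0; apply/min_idPl.
  under eq_fun do rewrite mulrC.
  exact: (cvgn_continuous (@continuous_min_scale R (X j w)) (@cvg_harmonic R)).
have D0 j : {ae P, forall w, h (j, true) w != 0}.
  have := K_na K1 (fun j => aeW _ _) j.
  move=> /(_ _)/wrap[]; first by move=> i w; rewrite indicE.
  apply: filterS => w; rewrite indicE; case: (boolP (w \in D j)); rewrite ?notin_setE ?inE /D/=.
    by move=> _ /eqP; rewrite oner_eq0.
  by move=> /eqP.
have XcvgX : {ae P, forall w j, toX (g k) j w @[k --> \oo] --> X j w}.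
  apply: filter_forall => j; apply: filterS3 hcvg (fcvg j) (D0 j) => w hc fc ht.
  apply: cvgB; last exact: fc.
  by apply: undamp_cvg => //; exact: (hc (j, true)).
have KX : K X.
  apply: (cc_closed cK (X := fun k => toX (g k))) => //; first by move=> k; case: (Sg k).
  by move=> j; apply: filterS XcvgX.
have tc : {ae P, forall w, tloss (toX (g k)) w @[k --> \oo] --> tloss X w}.
  apply: filterS XcvgX => w Xc; apply: cvg_big => [|j _]; first exact: add_continuous.
  exact: (cvgn_continuous (@continuous_loss R) (Xc j)).
(* Starting the sequence at k0 gives a bound on the means uniform in k; k0 tends to infinity at the
   end. *)
have fat k0 : intg (tloss X) /\ Ex (tloss X) <= s + k0.+1%:R^-1.
  apply: (@fatou_cvg _ _ _ P (fun k => tloss (toX (g (k + k0)%N)))) => //.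
  - by move=> k; case: (Sg (k + k0)%N) => _ _ _ [].
  - move=> k; case: (Sg (k + k0)%N) => _ _ _ [_ H] _; apply: (le_trans H).
    by rewrite lerD2l lef_pV2 ?posrE// ler_nat ltnS leq_addl.
  - exact: meas_tloss.
  - by apply: filterS tc => w tc; rewrite (cvg_shiftn k0 (fun k => tloss (toX (g k)) w)).
exists X; split => //; first by case: (fat 0%N).
apply: (@cvgn_ge R (fun k => s + harmonic k)) => [|k]; last by case: (fat k).
by rewrite -[X in _ --> X]addr0; apply: cvgD; [exact: cvg_cst|exact: cvg_harmonic].
Unshelve. all: by end_near. Qed.

(** Z is minus the derivative of the loss at the minimiser X. No differentiation under the integral
    is needed: the tangent at X + h Y, compared with the minimality of X, gives the inequality with
    that tangent's slope, and dominated convergence by |Y| lets h tend to 0. *)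
Theorem kreps_yan : exists Z : J -> Omega -> R,
  [/\ forall j, measurable_fun setT (Z j), forall j w, 0 < Z j w <= 1 &
   forall Y, K Y -> (forall j, intg (Y j)) ->
     \sum_j Ex (fun w => Z j w * Y j w) <= 0].
Proof.
have [X [KX iX Xs]] := minimizer.
have mX := cc_meas cK KX.
have mdd (U : Omega -> R) : measurable_fun setT U -> measurable_fun setT (fun w => damp (U w) ^+ 2).
  by move=> mU; apply: measurable_funX; apply: measurableT_comp => //; exact: measurable_damp.
have dd1 (x : R) : 0 < damp x ^+ 2 <= 1.
  by rewrite exprn_gt0 ?damp_gt0//= expr2 mulr_ile1 ?damp_le1// ltW// damp_gt0.
have ddn (x : R) : `|damp x ^+ 2| <= 1.
  by have /andP[d0 d1] := dd1 x; rewrite gtr0_norm.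
exists (fun j w => damp (X j w) ^+ 2); split => //.
- by move=> j; exact: mdd.
move=> Y KY iY; have mY := cc_meas cK KY.
pose XY i j w := X j w + harmonic i * Y j w.
have h0 i : 0 < harmonic i :> R by rewrite invr_gt0.
have mXY i j : measurable_fun setT (XY i j).
  by apply: measurable_funD => //; exact: measurable_funM.
have KXY i : K (XY i) by apply: (cc_add cK) => //; apply: K_pos => //; exact: ltW.
have iZY i j : intg (fun w => damp (XY i j w) ^+ 2 * Y j w).
  by apply: (@intgM _ _ _ _ (fun w => damp (XY i j w) ^+ 2) _ 1) => //; exact: mdd.
have iXY i : intg (tloss (XY i)).
  have iB : intg (fun w => tloss X w + \sum_j `|harmonic i * Y j w|).
    by apply: intgD => //; apply: intg_sum => j _; apply: intg_norm; exact: intgZ.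
  apply: (le_integrable measurableT _ _ iB); first exact/measurable_EFinP/meas_tloss.
  move=> w _ /=; rewrite lee_fin ger0_norm// ger0_norm; last first.
    by rewrite addr_ge0// sumr_ge0.
  by rewrite /tloss -big_split/=; apply: ler_sum => j _; exact: loss_lip.
have FOC i : \sum_j Ex (fun w => damp (XY i j w) ^+ 2 * Y j w) <= 0.
  have iS : intg (fun w => \sum_j damp (XY i j w) ^+ 2 * Y j w) by apply: intg_sum.
  rewrite -Ex_sum// -(pmulr_rle0 _ (h0 i)) -RintegralZl//.
  have le1 w : harmonic i * (\sum_j damp (XY i j w) ^+ 2 * Y j w) <= tloss X w - tloss (XY i) w.
    rewrite /tloss -sumrB mulr_sumr; apply: ler_sum => j _.
    have := loss_subgrad (X j w) (XY i j w); rewrite {2}/XY.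
    by rewrite opprD addrA subrr add0r mulrN opprK -lerBrDl mulrCA.
  apply: le_trans (Ex_le (intgZ _ iS) (intgB iX (iXY i)) (aeW _ le1)) _.
  by rewrite ExB// subr_le0; apply: (le_trans Xs); exact: s_le.
have lim j : Ex (fun w => damp (XY i j w) ^+ 2 * Y j w) @[i --> \oo] -->
    Ex (fun w => damp (X j w) ^+ 2 * Y j w).
  apply: (@Ex_dominated _ _ _ P _ _ (fun w => `|Y j w|)).
  - by move=> i; apply: measurable_funM => //; exact: mdd.
  - by apply: measurable_funM => //; exact: mdd.
  - exact: intg_norm.
  - by move=> i; apply: aeW => w; rewrite normrM ler_piMl.
  apply: aeW => w; apply: cvgM; last exact: cvg_cst.
  have XYc : XY i j w @[i --> \oo] --> X j w.
    rewrite -[X in _ --> X]addr0 -(mul0r (Y j w)); apply: cvgD; first exact: cvg_cst.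
    by apply: cvgM; [exact: cvg_harmonic|exact: cvg_cst].
  have dc : damp (XY i j w) @[i --> \oo] --> damp (X j w).
    exact: (cvgn_continuous (@continuous_damp R) XYc).
  by rewrite expr2; under eq_fun do rewrite expr2; exact: cvgM.
rewrite -oppr_ge0; apply: (@cvgn_ge R (fun i => - \sum_j Ex (fun w => damp (XY i j w) ^+ 2 * Y j w))).
  by apply: cvgN; apply: cvg_big => [|j _]; [exact: add_continuous|exact: lim].
by move=> i; rewrite oppr_ge0.
Qed.

End kreps_yan.

(** * Finitely generated cones over a filtration *)

Section finitely_generated.
Context {R : realType} {dd : measure_display} {Omega : measurableType dd}.
Variables (P : probability Omega R) (n : nat) (I : finType).
Local Notation intg X := (P.-integrable setT (EFin \o X)).
Local Notation Ex X := (\int[P]_w (X w))%R.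
Variables (G : I -> set (set Omega)) (f : I -> 'I_n -> Omega -> R) (B : I -> set Omega).
Hypotheses (sG : forall i, sigma_algebra setT (G i)) (Gm : forall i, G i `<=` measurable)
  (GB : forall i, G i (B i)) (f_intg : forall i k, intg (f i k)).

Definition admissible i (mu : Omega -> R) :=
  Gmeas (G i) mu /\ forall w, ~ B i w -> 0 <= mu w.

(** The abstract content of [KP] and [HN0], established for the model in [market_nondegenerate]. *)
Hypothesis nondegenerate : forall mu : I -> Omega -> R, (forall i, admissible i (mu i)) ->
  (forall k, {ae P, forall w, 0 <= \sum_i mu i w * f i k w}) ->
  (forall k, {ae P, forall w, \sum_i mu i w * f i k w = 0}) /\
  (forall i, {ae P, forall w, ~ B i w -> mu i w = 0}).

Let J : finType := ('I_n + I)%type.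

(* One extra coordinate per generator records its use outside B, so that a
   strictly positive dual variable on the enlarged space is strict there. *)
Let fx (i : I) (j : J) : Omega -> R :=
  match j with
  | inl k => f i k
  | inr i' => if i' == i then \1_(~` B i) else (fun=> 0)
  end.

Let GC i : G i (~` B i). Proof. exact: GmeasC. Qed.

Let adm0 i : admissible i (fun=> 0).
Proof. by split => //; exact: Gmeas_cst. Qed.

Let admD i mu nu : admissible i mu -> admissible i nu -> admissible i (fun w => mu w + nu w).
Proof.
by move=> [? mu0] [? nu0]; split; [exact: GmeasD|move=> w Bw; rewrite addr_ge0 ?mu0 ?nu0].
Qed.

Let adm_indic i D : G i D -> admissible i \1_D.
Proof. by move=> GD; split => [|w _]; [exact: Gmeas_indic|rewrite indicE]. Qed.

Let intg_fx i j : intg (fx i j).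
Proof.
case: j => [k|i'] /=; first exact: f_intg.
case: ifP => _; last exact: intg_cst.
by apply: integrable_indic => //; exact: (Gm (GC i)).
Qed.

Let meas_fx i j : measurable_fun setT (fx i j).
Proof. exact: intg_meas (intg_fx i j). Qed.

(** The head of the list is the generator added last, over the cone of the tail, so lists will be
    ordered by increasing sigma-algebras. *)
Fixpoint gcone (s : seq I) : (J -> Omega -> R) -> Prop :=
  if s is i :: s' then gen_cone (G i) (B i) (fx i) (gcone s')
  else fun X => (forall j, measurable_fun setT (X j)) /\ (forall j, {ae P, forall w, X j w <= 0}).

(** Domination by a combination of all generators, free of the recursive order of [gcone].
    Compensating elements are taken here, so that generators can be moved to that side. *)
Let rep (X : J -> Omega -> R) := exists2 mu : I -> Omega -> R,
  forall i, admissible i (mu i) &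
  forall j, {ae P, forall w, X j w <= \sum_i mu i w * fx i j w}.

Let repD X Y : rep X -> rep Y -> rep (fun j w => X j w + Y j w).
Proof.
move=> [mu amu Hmu] [nu anu Hnu]; exists (fun i w => mu i w + nu i w).
  by move=> i; exact: admD.
move=> j; apply: filterS2 (Hmu j) (Hnu j) => w h1 h2.
by under eq_bigr do rewrite mulrDl; rewrite big_split lerD.
Qed.

Let sum_single i nu (w : Omega) j :
  \sum_i' (if i' == i then nu w else 0) * fx i' j w = nu w * fx i j w.
Proof.
by rewrite (bigD1 i)//= eqxx big1 ?addr0// => i' /negPf ->; rewrite mul0r.
Qed.

Let rep_gen i nu : admissible i nu -> rep (fun j w => nu w * fx i j w).
Proof.
move=> anu; exists (fun i' w => if i' == i then nu w else 0).
  by move=> i'; case: eqP => [->|_]; [exact: anu|exact: adm0].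
by move=> j; apply: aeW => w; rewrite sum_single.
Qed.

Let nondeg_fx (mu : I -> Omega -> R) : (forall i, admissible i (mu i)) ->
  (forall j, {ae P, forall w, 0 <= \sum_i mu i w * fx i j w}) ->
  (forall j, {ae P, forall w, \sum_i mu i w * fx i j w = 0}) /\
  (forall i, {ae P, forall w, ~ B i w -> mu i w = 0}).
Proof.
move=> amu H; have [H1 H2] := nondegenerate amu (fun k => H (inl k)).
split => // -[k|i']; first exact: H1.
apply: filterS (H2 i') => w Hw.
rewrite (bigD1 i')//= eqxx big1 => [|i]; last first.
  by rewrite eq_sym => /negPf ->; rewrite mulr0.
rewrite addr0 indicE; case: (boolP (w \in ~` B i')); last by rewrite mulr0.
by rewrite inE => /Hw ->; rewrite mul0r.
Qed.

Let rep_na X : rep X -> (forall j, {ae P, forall w, 0 <= X j w}) ->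
  forall j, {ae P, forall w, X j w = 0}.
Proof.
move=> [mu amu Hmu] X0 j.
have [] := nondeg_fx amu _.
  by move=> j'; apply: filterS2 (X0 j') (Hmu j') => w; exact: le_trans.
move=> /(_ j) H _; apply: filterS3 H (Hmu j) (X0 j) => w -> h1 h2.
by apply/eqP; rewrite eq_le h1 h2.
Qed.

Let gcone_meas s X : gcone s X -> forall j, measurable_fun setT (X j).
Proof.
elim: s X => [|i s ih] X /=; first by case.
move=> [mu [k [mmu mu0 Kk ->]]] j; apply: measurable_funD; last exact: ih Kk j.
by apply: measurable_funM => //; exact: (Gmeas_meas (Gm (i:=i))).
Qed.

Let gcone_ae s X Y : gcone s X -> (forall j, measurable_fun setT (Y j)) ->
  (forall j, {ae P, forall w, X j w = Y j w}) -> gcone s Y.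
Proof.
elim: s X Y => [|i s ih] X Y /=.
  by move=> [_ X0] mY XY; split => // j; apply: filterS2 (X0 j) (XY j) => w + <-.
move=> [mu [k [mmu mu0 Kk ->]]] mY XY.
have mk := gcone_meas Kk.
exists mu, (fun j w => Y j w - mu w * fx i j w); split => //; last first.
  by apply/funext => j; apply/funext => w; ring.
apply: ih Kk _ _ => j; last by apply: filterS (XY j) => w <-; ring.
apply: measurable_funB => //; apply: measurable_funM => //.
exact: (Gmeas_meas (Gm (i:=i))).
Qed.

Let gcone_rep s X : gcone s X -> rep X.
Proof.
elim: s X => [|i s ih] X /=.
  move=> [_ X0]; exists (fun _ _ => 0); first by move=> i; exact: adm0.
  by move=> j; apply: filterS (X0 j) => w; rewrite big1// => i _; rewrite mul0r.
move=> [mu [k [mmu mu0 /ih Kk ->]]].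
exact: (repD (rep_gen (conj mmu mu0)) Kk).
Qed.

Let gcone0 s : gcone s (fun _ _ => 0).
Proof.
elim: s => [|i s ih] /=; first by split => // j; exact: aeW.
exists (fun=> 0), (fun _ _ => 0); split => //; first exact: Gmeas_cst.
by apply/funext => j; apply/funext => w; rewrite mul0r addr0.
Qed.

Let gcone_gen s i nu : i \in s -> admissible i nu -> gcone s (fun j w => nu w * fx i j w).
Proof.
move=> + anu; elim: s => [//|i' s ih] /=; rewrite inE => /predU1P[<-|/ih K].
  exists nu, (fun _ _ => 0); split; [by case: anu|by case: anu|exact: gcone0|].
  by apply/funext => j; apply/funext => w; rewrite addr0.
exists (fun=> 0), (fun j w => nu w * fx i j w); split => //; first exact: Gmeas_cst.
by apply/funext => j; apply/funext => w; rewrite mul0r add0r.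
Qed.

(* An element that can be compensated uses its generators only on the
   degenerate sets B, where negative coefficients are allowed. *)
Let gcone_opp s X Y : gcone s X -> rep Y -> (forall j, {ae P, forall w, 0 <= X j w + Y j w}) ->
  gcone s (fun j w => - X j w).
Proof.
elim: s X Y => [|i s ih] X Y /=.
  move=> [mX X0] rY XY; split; first by move=> j; exact: measurable_funN.
  have Y0 j : {ae P, forall w, Y j w = 0}.
    apply: rep_na => // j'; apply: filterS2 (X0 j') (XY j') => w; lra.
  by move=> j; apply: filterS2 (Y0 j) (XY j) => w ->; rewrite addr0 oppr_le0.
move=> [nu [k [mnu nu0 Kk ->]]] rY XY.
have rk := gcone_rep Kk.
have mk := gcone_meas Kk.
(* For the tail, the head generator joins the compensating side. *)
have Kk' : gcone s (fun j w => - k j w).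
  apply: (ih _ (fun j w => nu w * fx i j w + Y j w)) => //.
    exact: repD (rep_gen (conj mnu nu0)) rY.
  by move=> j; apply: filterS (XY j) => w; rewrite addrA (addrC (k j w)).
(* In the total combination generator i has coefficient nu + mu i, which vanishes off B; both
   summands are nonnegative there, so nu vanishes too. *)
have nuB : {ae P, forall w, ~ B i w -> nu w = 0}.
  have [mu amu Hmu] := repD rk rY.
  have amu' i' : admissible i' (fun w => (if i' == i then nu w else 0) + mu i' w).
    apply: admD => //; case: eqP => [->|_]; [exact: (conj mnu nu0)|exact: adm0].
  have [|_ /(_ i)] := nondeg_fx amu'.
    move=> j; apply: filterS2 (Hmu j) (XY j) => w h1 h2.
    under eq_bigr do rewrite mulrDl.
    rewrite big_split/= sum_single; apply: (le_trans h2).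
    by rewrite -addrA lerD2l.
  apply: filterS => w H Bw; have := H Bw; rewrite eqxx => E.
  by have := nu0 w Bw; have := (amu i).2 w Bw; lra.
(* Admissibility asks for the sign at every point off B, while nu vanishes there only a.e. Cutting
   by the indicator repairs this, and the a.e. null correction goes into the tail. *)
exists (fun w => - nu w * \1_(B i) w),
  (fun j w => - k j w - nu w * (1 - \1_(B i) w) * fx i j w); split.
- apply: GmeasM => //; [exact: GmeasN|exact: Gmeas_indic].
- by move=> w Bw; rewrite indicE memNset// mulr0.
- apply: gcone_ae Kk' _ _ => j.
    apply: measurable_funB; first exact: measurable_funN.
    apply: measurable_funM => //; apply: (Gmeas_meas (Gm (i:=i))).
    apply: GmeasM => //; apply: GmeasB => //; [exact: Gmeas_cst|exact: Gmeas_indic].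
  apply: filterS nuB => w nuB; rewrite indicE.
  case: (boolP (w \in B i)); first by rewrite subrr mulr0 mul0r subr0.
  by rewrite notin_setE => /nuB ->; rewrite !mul0r subr0.
- by apply/funext => j; apply/funext => w; ring.
Qed.

(** The cone of the tail must be stable under [G i]-measurable factors when i is added; the pairwise
    inclusions and the generality in G0 provide this in the induction. *)
Lemma gcone_ccone s G0 : sigma_algebra setT G0 -> G0 `<=` measurable ->
  (forall i, i \in s -> G0 `<=` G i) -> pairwise (fun i j => `[< G i `<=` G j >]) s ->
  ccone P G0 (gcone s).
Proof.
elim: s G0 => [|i s ih] G0 sG0 G0m /= G0s.
  move=> _; split => /=.
  - by move=> X [].
  - by [].
  - move=> X Y [mX X0] [mY Y0]; split=> j; first exact: measurable_funD.
    by apply: filterS2 (X0 j) (Y0 j) => w; lra.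
  - move=> h X mh h0 [mX X0]; split=> j.
      by apply: measurable_funM => //; exact: (Gmeas_meas G0m).
    by apply: filterS (X0 j) => w Xle; rewrite mulr_ge0_le0.
  - move=> X Y KX mY XY; split => // j.
    have := ae_foralln (fun k => (KX k).2 j); apply: filterS2 (XY j) => w XYw X0.
    rewrite -oppr_ge0; apply: (@cvgn_ge R (fun k => - X k j w)); first exact: cvgN.
    by move=> k; rewrite oppr_ge0.
move=> /andP[/allP iG ps].
apply: (@ccone_sub _ _ _ _ _ (G i)); first by apply: G0s; rewrite inE eqxx.
have ck : ccone P (G i) (gcone s).
  by apply: ih => // i' i's; apply/asboolP; exact: iG.
apply: (gen_cone_ccone (sG i) (Gm (i:=i)) ck (meas_fx i)).
(* The compensating element is the generator on D, and in the next case its opposite, which is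
   admissible because D lies in B. *)
- move=> D GD KD; have := gcone_opp KD (rep_gen (adm_indic GD)).
  move=> /(_ _)/wrap[].
    by move=> j; apply: aeW => w; rewrite mulNr addNr.
  by congr gcone; apply/funext => j; apply/funext => w; rewrite mulNr opprK.
- move=> D GD DB KD.
  have aD : admissible i (fun w => - \1_D w).
    split; first by apply: GmeasN => //; exact: Gmeas_indic.
    by move=> w Bw; rewrite indicE memNset ?oppr0// => /DB.
  have := gcone_opp KD (rep_gen aD).
  move=> /(_ _)/wrap[].
    by move=> j; apply: aeW => w; rewrite mulNr addrN.
  by congr gcone; apply/funext => j; apply/funext => w; rewrite mulNr.
Qed.

Theorem strict_dual_variable (s : seq I) : (forall i, i \in s) ->
  pairwise (fun i j => `[< G i `<=` G j >]) s ->
  exists (Z : 'I_n -> Omega -> R) (zeta : I -> Omega -> R),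
    [/\ forall k, measurable_fun setT (Z k), forall k w, 0 < Z k w <= 1,
        forall i, measurable_fun setT (zeta i), forall i w, 0 < zeta i w <= 1 &
        forall i D, G i D ->
          Ex (fun w => \1_D w * \sum_k Z k w * f i k w) +
          Ex (fun w => \1_D w * (zeta i w * \1_(~` B i) w)) <= 0].
Proof.
move=> sI ps.
(* [kreps_yan] rescales by constants only, so the trivial sigma-algebra, contained in every G i, is
   enough. *)
have sG0 : sigma_algebra setT (<<s (set0 : set (set Omega)) >>) by exact: smallest_sigma_algebra.
have G0s i : <<s (set0 : set (set Omega)) >> `<=` G i by apply: smallest_sub.
have G0m : <<s (set0 : set (set Omega)) >> `<=` (measurable : set (set Omega)).
  by apply: smallest_sub => //; exact: sigma_algebra_measurable.
have ck := gcone_ccone sG0 G0m (fun i _ => G0s i) ps.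
have [Z [mZ Z1 ZK]] := kreps_yan sG0 ck (fun X KX => rep_na (gcone_rep KX)).
exists (fun k => Z (inl k)), (fun i => Z (inr i)); split => // i D GD.
have mD := Gm GD.
have := ZK _ (gcone_gen (sI i) (adm_indic GD)) _.
move=> /(_ _)/wrap[]; first by move=> j; exact: intg_indic.
have iZ j (U : Omega -> R) : intg U -> intg (fun w => Z j w * U w).
  move=> iU; apply: (@intgM _ _ _ _ (Z j) U 1) => // w.
  by have /andP[z0 z1] := Z1 j w; rewrite gtr0_norm.
rewrite big_sumType/=; congr (_ + _ <= _).
  under [RHS]eq_Rintegral do rewrite mulr_sumr.
  rewrite Ex_sum => [|k _]; last first.
    by apply: intg_indic => //; apply: iZ; exact: f_intg.
  by apply: eq_bigr => k _; apply: eq_Rintegral => w _; rewrite mulrCA.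
rewrite (bigD1 i)//= big1 ?addr0 => [|i' /negPf ni].
  by apply: eq_Rintegral => w _; rewrite eqxx mulrCA.
under eq_Rintegral do rewrite ni !mulr0.
by rewrite Rintegral_cst// mul0r.
Qed.

End finitely_generated.

(** * Generalised supermartingale differences *)

Section generalized_supermartingale.
Context {R : realType} {dd : measure_display} {Omega : measurableType dd}.
Variables (P : probability Omega R).
Local Notation intg X := (P.-integrable setT (EFin \o X)).
Local Notation Ex X := (\int[P]_w (X w))%R.
Variables (H : nat -> set (set Omega)).

Lemma prodr_itv01 (r : seq nat) (p : pred nat) (g : nat -> R) :
  (forall i, i \in r -> 0 < g i <= 1) -> 0 < \prod_(i <- r | p i) g i <= 1.
Proof.
move=> g1; rewrite big_seq_cond; apply: (big_ind (fun x => 0 < x <= 1)).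
- by rewrite ltr01 lexx.
- by move=> x y /andP[x0 x1] /andP[y0 y1]; rewrite mulr_gt0// mulr_ile1// ltW.
- by move=> i /andP[ir _]; exact: g1.
Qed.

(* Y t need not be integrable: integrability and the sign of the conditional
   expectation are only required after multiplication by the H t-measurable
   density g t. *)
Lemma generalized_supermartingale_eq0 T (g Y : nat -> Omega -> R) :
  (forall t, (t <= T)%N -> sigma_algebra setT (H t)) ->
  (forall t, (t <= T)%N -> H t `<=` measurable) ->
  (forall s t, (s <= t)%N -> (t <= T)%N -> H s `<=` H t) ->
  (forall t, (t <= T)%N -> Gmeas (H t) (g t)) ->
  (forall t w, (t <= T)%N -> 0 < g t w <= 1) ->
  (forall t, (t <= T)%N -> intg (fun w => g t w * Y t w)) ->
  (forall t h, (t <= T)%N -> Gmeas (H t) h -> (forall w, 0 <= h w <= 1) ->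
    Ex (fun w => h w * (g t w * Y t w)) <= 0) ->
  {ae P, forall w, 0 <= \sum_(t < T.+1) Y t w} ->
  {ae P, forall w, \sum_(t < T.+1) Y t w = 0}.
Proof.
elim: T Y => [|T ih] Y sH Hm Hf mg g1 igY gY S0.
  have one01 (w : Omega) : 0 <= (1 : R) <= 1 by rewrite ler01 lexx.
  have EY : Ex (fun w => g 0%N w * Y 0%N w) <= 0.
    have := gY 0%N (fun=> 1) (leqnn 0) (Gmeas_cst (sH _ (leqnn 0)) 1) one01.
    by under eq_Rintegral do rewrite mul1r.
  have gY0 : {ae P, forall w, 0 <= g 0%N w * Y 0%N w}.
    apply: filterS S0 => w; rewrite big_ord1 => Y0.
    by rewrite mulr_ge0//; have /andP[/ltW] := g1 0%N w (leqnn 0).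
  apply: filterS (Ex_ae_eq0 (igY _ (leqnn 0)) gY0 EY) => w /eqP.
  rewrite big_ord1 mulf_eq0 => /orP[/eqP g0|/eqP//].
  by have := g1 0%N w (leqnn 0); rewrite g0 ltxx.
(* Conditioning on H T.+1 replaces Y s, s <= T, by Y' s and reduces the horizon. *)
have leTS t : (t <= T)%N -> (t <= T.+1)%N by move=> /leqW.
have sT := sH _ (leqnn T.+1); have mT := Hm _ (leqnn T.+1).
pose r := index_iota 0 T.+2.
have rP t : (t \in r) = (t <= T.+1)%N by rewrite mem_index_iota.
(* The product of all densities makes every term integrable at once; q s is what it contains besides
   g s, and it is a bounded H T.+1-measurable factor. *)
pose q s w := \prod_(t <- r | t != s) g t w.
have gE s w : (s <= T.+1)%N -> \prod_(t <- r) g t w = q s w * g s w.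
  by move=> sT1; rewrite (bigD1_seq s) ?iota_uniq ?rP//= mulrC.
have q01 s w : 0 < q s w <= 1 by apply: prodr_itv01 => t; rewrite rP; exact: g1.
have mgT t : (t <= T.+1)%N -> Gmeas (H T.+1) (g t).
  by move=> tT C mC; apply: (Hf t) => //; exact: mg.
have mq s : Gmeas (H T.+1) (q s).
  by apply: Gmeas_prod => // t; rewrite rP; exact: mgT.
have one01 (w : Omega) : 0 <= (1 : R) <= 1 by rewrite ler01 lexx.
pose ce s := cexp P (H T.+1) (fun w => g s w * Y s w).
(* Conditional expectation of the possibly nonintegrable Y s: g s is H T.+1-measurable, so it can be
   multiplied in before conditioning and divided out afterwards. *)
pose Y' s w := ce s w / g s w.
have gn0 s w : (s <= T.+1)%N -> g s w != 0.
  by move=> /(g1 s w) /andP[/lt0r_neq0].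
have gY'E s : (s <= T.+1)%N -> (fun w => g s w * Y' s w) = ce s.
  by move=> sT1; apply/funext => w; rewrite /Y' mulrCA divff ?mulr1// gn0.
have ice s : (s <= T.+1)%N -> intg (ce s).
  by move=> sT1; apply: (cexp_intg sT mT); exact: igY.
have ceE s h : (s <= T.+1)%N -> Gmeas (H T.+1) h -> (forall w, 0 <= h w <= 1) ->
    Ex (fun w => h w * ce s w) = Ex (fun w => h w * (g s w * Y s w)).
  by move=> sT1 mh h1; apply: (cexp_mul sT mT) h1 => //; exact: igY.
pose gam w := \prod_(t <- r) g t w.
pose W w := gam w * \sum_(t < T.+1) Y' t w.
pose U w := gam w * \sum_(t < T.+1) Y t w.
have UE : U = fun w => \sum_(t < T.+1) q t w * (g t w * Y t w).
  apply/funext => w; rewrite /U mulr_sumr; apply: eq_bigr => t _.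
  by rewrite mulrA -gE// ltnW.
have WE : W = fun w => \sum_(t < T.+1) q t w * ce t w.
  apply/funext => w; rewrite /W mulr_sumr; apply: eq_bigr => t _.
  have tT : (t <= T.+1)%N by exact: ltnW.
  by rewrite -gY'E// mulrA -gE.
have mq' s : measurable_fun setT (q s) by exact: (Gmeas_meas mT).
have qn s w : `|q s w| <= 1 by have /andP[q0 q1] := q01 s w; rewrite gtr0_norm.
have iqY s : (s <= T.+1)%N -> intg (fun w => q s w * (g s w * Y s w)).
  by move=> sT1; apply: (@intgM _ _ _ _ (q s) _ 1) => //; exact: igY.
have iqc s : (s <= T.+1)%N -> intg (fun w => q s w * ce s w).
  by move=> sT1; apply: (@intgM _ _ _ _ (q s) _ 1) => //; exact: ice.
have iU : intg U.
  by rewrite UE; apply: intg_sum => t _; apply: iqY; exact: ltnW.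
have iW : intg W.
  by rewrite WE; apply: intg_sum => t _; apply: iqc; exact: ltnW.
have mW : Gmeas (H T.+1) W.
  rewrite WE; apply: Gmeas_sum => // t _; apply: GmeasM => //.
  by apply: (cexp_meas sT mT); apply: igY; exact: ltnW.
have EWU A : H T.+1 A -> Ex (fun w => \1_A w * W w) = Ex (fun w => \1_A w * U w).
  move=> HA; rewrite UE WE.
  under eq_Rintegral do rewrite mulr_sumr.
  under [RHS]eq_Rintegral do rewrite mulr_sumr.
  rewrite !Ex_sum => [|t _|t _]; last 2 first.
  - by apply: intg_indic; [exact: mT|apply: iqY; exact: ltnW].
  - by apply: intg_indic; [exact: mT|apply: iqc; exact: ltnW].
  apply: eq_bigr => t _.
  transitivity (Ex (fun w => \1_A w * q t w * ce t w)).
    by apply: eq_Rintegral => w _; rewrite mulrA.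
  transitivity (Ex (fun w => \1_A w * q t w * (g t w * Y t w))); last first.
    by apply: eq_Rintegral => w _; rewrite -[LHS]mulrA.
  apply: (@ceE t (fun w => \1_A w * q t w)); [exact: ltnW|by apply: GmeasM => //; exact: Gmeas_indic|].
  move=> w; rewrite indicE; have /andP[q0 q1] := q01 t w.
  by case: (_ \in _); rewrite ?mul1r ?mul0r ?lexx ?ler01// q1 ltW.
have lastE A : H T.+1 A -> Ex (fun w => \1_A w * (q T.+1 w * (g T.+1 w * Y T.+1 w))) <= 0.
  move=> HA.
  rewrite (@eq_Rintegral _ _ _ P setT (fun w => \1_A w * q T.+1 w * (g T.+1 w * Y T.+1 w))); last first.
    by move=> w _; rewrite ?mulrA.
  apply: (gY _ (fun w => \1_A w * q T.+1 w)) => //; first by apply: GmeasM => //; exact: Gmeas_indic.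
  move=> w; rewrite indicE; have /andP[q0 q1] := q01 T.+1 w.
  by case: (_ \in _); rewrite ?mul1r ?mul0r ?lexx ?ler01// q1 ltW.
have gam0 w : 0 < gam w.
  by have := @prodr_itv01 r xpredT (g ^~ w); move=> /(_ _)/wrap[t|/andP[]//]; rewrite rP; exact: g1.
have SE w : gam w * \sum_(t < T.+2) Y t w = U w + q T.+1 w * (g T.+1 w * Y T.+1 w).
  by rewrite big_ord_recr/= mulrDr /U mulrA -gE.
have gS0 : {ae P, forall w, 0 <= gam w * \sum_(t < T.+2) Y t w}.
  by apply: filterS S0 => w S0; rewrite mulr_ge0// ltW.
have iS : intg (fun w => gam w * \sum_(t < T.+2) Y t w).
  by under eq_fun do rewrite SE; apply: intgD => //; exact: iqY.
(* For A in H T.+1, E[1_A W] = E[1_A U], and this is at least the mean over A of the full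
   nonnegative sum, because the last term has nonpositive mean there. *)
have W0 : {ae P, forall w, - W w <= 0}.
  apply: (Gmeas_ae_le0 sT mT) => [||A HA]; first exact: GmeasN.
    by under eq_fun do rewrite -mulN1r; exact: intgZ.
  under eq_Rintegral do rewrite mulrN -mulN1r.
  rewrite RintegralZl//; last by apply: intg_indic => //; exact: mT.
  rewrite EWU// mulN1r oppr_le0 -(lerDr (Ex (fun w => \1_A w * (q T.+1 w * (g T.+1 w * Y T.+1 w))))).
  apply: (le_trans (lastE _ HA)).
  rewrite -ExD; [|by apply: intg_indic; [exact: mT|]|by apply: intg_indic; [exact: mT|exact: iqY]].
  apply: Ex_ae_ge0.
    apply: measurable_funD; apply: intg_meas; apply: intg_indic; [exact: mT|exact: iU|exact: mT|exact: iqY].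
  apply: filterS gS0 => w; rewrite SE -mulrDr => S0w.
  by rewrite mulr_ge0// indicE.
have Y'0 : {ae P, forall w, 0 <= \sum_(t < T.+1) Y' t w}.
  apply: filterS W0 => w; rewrite oppr_le0 /W pmulr_rge0//.
have : {ae P, forall w, \sum_(t < T.+1) Y' t w = 0}.
  apply: ih => //.
  - by move=> t tT; exact: (sH t (leTS _ tT)).
  - by move=> t tT; exact: (Hm t (leTS _ tT)).
  - by move=> u t ut tT; exact: (Hf u t ut (leTS _ tT)).
  - by move=> t tT; exact: (mg t (leTS _ tT)).
  - by move=> t w tT; exact: (g1 t w (leTS _ tT)).
  - by move=> t /leTS tT; rewrite gY'E//; exact: ice.
  - move=> t h tT mh h1; have tT1 := leTS _ tT.
    rewrite (_ : (fun w => h w * _) = (fun w => h w * ce t w)); last first.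
      by apply/funext => w; rewrite -gY'E.
    rewrite ceE//; first exact: gY.
    by move=> C mC; apply: (Hf t) => //; exact: mh.
move=> Y'eq0.
(* The induction gives W = 0, hence E[U] = 0; the nonnegative full sum then has nonpositive mean. *)
have EU : Ex U = 0.
  have := EWU setT (GmeasT sT).
  rewrite (_ : (fun w => \1_setT w * W w) = W); last by apply/funext => w; rewrite indicT mul1r.
  rewrite (_ : (fun w => \1_setT w * U w) = U); last by apply/funext => w; rewrite indicT mul1r.
  move=> <-; rewrite (@Ex_ae_eq _ _ _ P W (fun=> 0))//.
  - by rewrite Rintegral_cst// mul0r.
  - by apply: filterS Y'eq0 => w; rewrite /W => ->; rewrite mulr0.
  - exact: intg_meas iW.
have ES : Ex (fun w => gam w * \sum_(t < T.+2) Y t w) <= 0.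
  under eq_Rintegral do rewrite SE.
  rewrite ExD//; last exact: iqY.
  rewrite EU add0r; have := lastE setT (GmeasT sT).
  by under eq_Rintegral do rewrite indicT mul1r.
apply: filterS (Ex_ae_eq0 iS gS0 ES) => w /eqP; rewrite mulf_eq0 => /orP[/eqP g0|/eqP//].
by have := gam0 w; rewrite g0 ltxx.
Qed.

End generalized_supermartingale.

(** * The model *)

Section signed_units.
Context {R : realType} {n : nat}.

Definition sidx : finType := ('I_n * 'I_n * bool)%type.

Definition flip (m : sidx) : sidx := (m.1, ~~ m.2).

Lemma flipK : involutive flip.
Proof. by case=> ij b; rewrite /flip/= negbK. Qed.

Definition unit_mx (m : sidx) : 'M[R]_n :=
  if m.2 then delta_mx m.1.1 m.1.2 else - delta_mx m.1.1 m.1.2.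

Lemma unit_mx_flip m : unit_mx (flip m) = - unit_mx m.
Proof. by case: m => ij [] /=; rewrite /unit_mx/= ?opprK. Qed.

Lemma unit_mx_sgn m : exists2 d : R, d = 1 \/ d = -1 & unit_mx m = d *: delta_mx m.1.1 m.1.2.
Proof.
rewrite /unit_mx; case: m.2; [exists 1; [by left|by rewrite scale1r]|].
by exists (-1); [right|rewrite scaleN1r].
Qed.

Definition spart (m : sidx) (a : 'M[R]_n) : R :=
  if m.2 then Num.max (a m.1.1 m.1.2) 0 else Num.max (- a m.1.1 m.1.2) 0.

Lemma spart_ge0 m a : 0 <= spart m a.
Proof. by rewrite /spart; case: ifP => _; rewrite le_max lexx orbT. Qed.

Lemma spart_flip m a : spart m a = 0 \/ spart (flip m) a = 0.
Proof.
case: m => [[i j] b]; rewrite /spart/flip/=.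
have /orP[a0|a0] := le_total 0 (a i j); case: b => /=.
- by right; apply/max_idPr; rewrite oppr_le0.
- by left; apply/max_idPr; rewrite oppr_le0.
- by left; apply/max_idPr.
- by right; apply/max_idPr.
Qed.

Lemma sum_sidx (V : nmodType) (phi : sidx -> V) :
  \sum_m phi m = \sum_i \sum_j (phi (i, j, true) + phi (i, j, false)).
Proof.
rewrite (pair_bigA _ (fun i j => phi (i, j, true) + phi (i, j, false)))/=.
rewrite (eq_bigr (fun ij => \sum_b phi (ij.1, ij.2, b))) => [|ij _]; last by rewrite big_bool.
rewrite (pair_bigA _ (fun ij b => phi (ij.1, ij.2, b)))/=.
by apply: eq_bigr => -[[i j] b].
Qed.

Lemma sum_unit_mx (c : sidx -> R) i j :
  (\sum_m c m *: unit_mx m) i j = c (i, j, true) - c (i, j, false).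
Proof.
rewrite sum_sidx.
rewrite (_ : \sum_i \sum_j _ = \matrix_(i, j) (c (i, j, true) - c (i, j, false))) ?mxE//.
rewrite [RHS]matrix_sum_delta; apply: eq_bigr => i' _; apply: eq_bigr => j' _.
by rewrite /unit_mx/= mxE scalerN scalerBl.
Qed.

(** [HA] decomposes F_t along entrywise positive and negative parts only. Nonnegative coefficients
    that never charge both a direction and its opposite are such parts. *)
Lemma spart_sum_unit_mx (c : sidx -> R) m : (forall m, 0 <= c m) ->
  c m = 0 \/ c (flip m) = 0 -> spart m (\sum_m c m *: unit_mx m) = c m.
Proof.
case: m => [[i j] b] c0; rewrite /spart sum_unit_mx /flip/= opprB.
case: b => /= -[] ->; rewrite ?subr0 ?sub0r; first [exact/max_idPl/c0 | apply/max_idPr].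
all: by rewrite oppr_le0.
Qed.

End signed_units.

(** * The maps F_t along signed matrix units *)

Section market.
Context {R : realType} {dd : measure_display} {Omega : measurableType dd}.
Variables (P : probability Omega R) (T n : nat) (H : nat -> set (set Omega))
  (Acone : set 'M[R]_n) (F : nat -> Omega -> 'M[R]_n -> 'rV[R]_n).
Local Notation intg X := (P.-integrable setT (EFin \o X)).
Local Notation Ex X := (\int[P]_w (X w))%R.
Local Notation sidx := (@sidx n).
Hypotheses (sH : forall t, (t <= T)%N -> sigma_algebra setT (H t))
  (Hm : forall t, (t <= T)%N -> H t `<=` measurable)
  (Hf : forall s t, (s <= t)%N -> (t <= T)%N -> H s `<=` H t)
  (A0 : Acone 0) (AD : forall a b, Acone a -> Acone b -> Acone (a + b))
  (AZ : forall (l : R) a, 0 <= l -> Acone a -> Acone (l *: a))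
  (hF : inBoldF P T Acone F) (hA : HA P T Acone F) (hI : condI P T F).

Let fe t (m : sidx) w : 'rV[R]_n := F t w (unit_mx m).

Lemma fe_intg t m k : (t <= T)%N -> intg (fun w => fe t m w 0 k).
Proof.
move=> tT; have [h1 h2] := hI tT m.1.1 m.1.2 k.
by rewrite /fe /unit_mx; case: m.2.
Qed.

Lemma fe_out t m : (t <= T)%N -> ~ Acone (unit_mx m) -> {ae P, forall w, fe t m w = 0}.
Proof.
move=> tT; have [d d1 E] := unit_mx_sgn (R := R) m; rewrite E => nA.
have [+ _] := hA tT => /(_ d m.1.1 m.1.2 d1 nA).
by apply: filterS => w; rewrite /fe E.
Qed.

Lemma F_hom t : (t <= T)%N -> {ae P, forall w, forall (l : R) a, 0 <= l ->
  F t w (l *: a) = l *: F t w a}.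
Proof. by move=> tT; apply: filterS (hF tT).2 => w []. Qed.

Lemma F_eq0 t : (t <= T)%N -> {ae P, forall w, F t w 0 = 0}.
Proof.
move=> tT; apply: filterS (F_hom tT) => w /(_ 0 0 (lexx 0)).
by rewrite !scale0r.
Qed.

Lemma F_superadd t : (t <= T)%N -> {ae P, forall w, forall (I : Type) (r : seq I) (p : pred I)
  (a : I -> 'M[R]_n), (forall i, p i -> Acone (a i)) -> forall k,
  \sum_(i <- r | p i) F t w (a i) 0 k <= F t w (\sum_(i <- r | p i) a i) 0 k}.
Proof.
move=> tT; apply: filterS2 (F_eq0 tT) (hF tT).2 => w Fw0 [_ _ sup] I r p a Aa k.
elim: r => [|i r ih]; first by rewrite !big_nil Fw0 mxE.
rewrite !big_cons; case: ifP => // pi; apply: (le_trans (lerD (lexx _) ih)).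
have As : Acone (\sum_(i <- r | p i) a i) by apply: big_ind => //.
have := sup 1 1 (a i) _ ler01 ler01 (Aa _ pi) As k.
by rewrite !scale1r !mxE subr_ge0.
Qed.

Lemma F_mx_sum t eta : (t <= T)%N -> Gmeas_mx measurable eta ->
  {ae P, forall w, F t w (eta w) = \sum_m spart m (eta w) *: fe t m w}.
Proof.
move=> tT meta; have [_ /(_ eta meta)] := hA tT.
apply: filterS => w; rewrite /Fapp => ->.
by rewrite sum_sidx; apply: eq_bigr => i _; apply: eq_bigr => j _.
Qed.

Lemma Gmeas_mx_meas t (eta : Omega -> 'M[R]_n) : (t <= T)%N ->
  Gmeas_mx (H t) eta -> Gmeas_mx measurable eta.
Proof. by move=> tT me i j B mB; apply: (Hm tT); exact: me. Qed.

Lemma Gmeas_spart t (eta : Omega -> 'M[R]_n) m : (t <= T)%N ->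
  Gmeas_mx (H t) eta -> Gmeas (H t) (fun w => spart m (eta w)).
Proof.
move=> tT me; have s := sH tT; rewrite /spart; case: m.2; apply: Gmeas_max => //.
- exact: Gmeas_cst.
- exact: GmeasN.
- exact: Gmeas_cst.
Qed.

Lemma Gmeas_mx_sum t (c : sidx -> Omega -> R) (a : sidx -> 'M[R]_n) : (t <= T)%N ->
  (forall m, Gmeas (H t) (c m)) -> Gmeas_mx (H t) (fun w => \sum_m c m w *: a m).
Proof.
move=> tT mc i j; have s := sH tT.
rewrite (_ : (fun w => _) = (fun w => \sum_m c m w * a m i j)); last first.
  by apply/funext => w; rewrite summxE; apply: eq_bigr => m _; rewrite mxE.
by apply: Gmeas_sum => // m _; apply: GmeasM => //; exact: Gmeas_cst.
Qed.

Lemma Gmeas_mx0 t : (t <= T)%N -> Gmeas_mx (H t) (fun=> 0 : 'M[R]_n).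
Proof.
move=> tT i j; rewrite [X in Gmeas _ X](_ : _ = fun=> 0).
  exact: (Gmeas_cst (sH tT)).
by apply/funext => w; rewrite mxE.
Qed.

Lemma Acone_sum I (r : seq I) (p : pred I) (a : I -> 'M[R]_n) :
  (forall i, p i -> Acone (a i)) -> Acone (\sum_(i <- r | p i) a i).
Proof. by move=> Aa; apply: big_ind. Qed.

Lemma inNP t xi : (t <= T)%N -> inN P H Acone F t xi <->
  exists eta, [/\ Gmeas_mx (H t) eta, forall w, Acone (eta w) &
    {ae P, forall w, xi w = F t w (eta w)}].
Proof.
move=> tT; split=> [[eta [[eta' [me Ae ee]] xe]]|[eta [me Ae xe]]].
  by exists eta'; split => //; apply: filterS2 ee xe => w + ->; rewrite /Fapp => ->.
exists eta; split => //; exists eta; split => //; exact: aeW.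
Qed.

Lemma inN_meas t xi : (t <= T)%N -> inN P H Acone F t xi -> exists xi' : Omega -> 'rV[R]_n,
  (forall k, measurable_fun setT (fun w => xi' w 0 k)) /\ {ae P, forall w, xi w = xi' w}.
Proof.
move=> tT /(inNP _ tT)[eta [me Ae xe]].
exists (fun w => \sum_m spart m (eta w) *: fe t m w); split.
  move=> k; rewrite (_ : (fun w => _) = (fun w => \sum_m spart m (eta w) * fe t m w 0 k)); last first.
    by apply/funext => w; rewrite summxE; apply: eq_bigr => m _; rewrite mxE.
  apply/GmeasE; apply: (Gmeas_sum (sigma_algebra_measurable Omega)) => m _.
  apply/GmeasE/measurable_funM; last exact: intg_meas (fe_intg _ _ tT).
  by apply: (Gmeas_meas (Hm tT)); exact: Gmeas_spart.
by apply: filterS2 xe (F_mx_sum tT (Gmeas_mx_meas tT me)) => w ->.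
Qed.

(** * From an element of D(F) to NA^w *)

Let U (Z : Omega -> 'rV[R]_n) t m w : R := dotv (Z w) (fe t m w).

Lemma dotv_sum (u : 'rV[R]_n) (I : Type) (r : seq I) (c : I -> R) (v : I -> 'rV[R]_n) :
  dotv u (\sum_(i <- r) c i *: v i) = \sum_(i <- r) c i * dotv u (v i).
Proof.
rewrite /dotv; under [RHS]eq_bigr do rewrite mulr_sumr.
rewrite exchange_big; apply: eq_bigr => k _; rewrite summxE mulr_sumr.
by apply: eq_bigr => i _; rewrite mxE mulrCA.
Qed.

Lemma dotv_intg Z t m : inLinf P Z -> (t <= T)%N -> intg (U Z t m).
Proof.
move=> [mZ [M ZM]] tT; apply: intg_sum => k _.
(* Z is bounded only a.e.; its truncation is bounded everywhere and a.e. equal to it. *)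
pose h w := Num.max (- M) (Num.min (Z w 0 k) M).
have mZk : measurable_fun setT (fun w => Z w 0 k) by exact/GmeasE.
have mh : measurable_fun setT h by apply: measurable_maxr => //; exact: measurable_minr.
have fk := fe_intg m k tT.
have M0 w : `|h w| <= `|M|.
  rewrite /h ler_norml le_max ge_max ge_min lerN2 ler_norm /= orbT andbT.
  by rewrite -normrN ler_norm.
apply: (@intg_ae_eq _ _ _ P (fun w => h w * fe t m w 0 k)).
- exact: intgM mh M0 fk.
- by apply: measurable_funM => //; exact: intg_meas fk.
- apply: filterS ZM => w /(_ k); rewrite ler_norml => /andP[Z1 Z2].
  by rewrite /h (min_idPl Z2) (max_idPr Z1).
Qed.

Lemma barFE t eta Z w :
  barF P H F t eta Z w = \sum_m spart m (eta w) * cexp P (H t) (U Z t m) w.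
Proof. by rewrite sum_sidx. Qed.

Theorem NAw_of_inD Z : inD P T H Acone F Z -> NAw P T H Acone F.
Proof.
move=> [LZ Z0 DZ]; split; last first.
  have N0 t : (t <= T)%N -> inN P H Acone F t (fun=> 0).
    move=> tT; apply/(inNP _ tT); exists (fun=> 0); split => //.
      exact: Gmeas_mx0.
    by apply: filterS (F_eq0 tT) => w ->.
  have L0 : inL0plus P (fun=> 0 : 'rV[R]_n).
    exists (fun=> 0); split; last exact: aeW.
      move=> k; apply/GmeasE; rewrite (_ : (fun _ => _) = (fun=> 0))//.
      by apply/funext => w; rewrite mxE.
    by move=> w k; rewrite mxE.
  split => //; exists (fun _ _ => 0), (fun=> 0); split => //.
  by apply: aeW => w; rewrite /VT big1// subr0.
move=> X [xi [r [Nxi [r' [mr' r'0 rr']] XV]]] [X' [mX' X'0 XX']].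
have Hxi t : exists eta, (t <= T)%N -> [/\ Gmeas_mx (H t) eta, forall w, Acone (eta w) &
    {ae P, forall w, xi t w = F t w (eta w)}].
  have [tT|tT] := leqP t T; last by exists (fun=> 0).
  by have /(inNP _ tT)[eta ?] := Nxi t tT; exists eta.
have {Hxi}[eta Heta] := choice Hxi.
have LA : L0Aproc P T H Acone eta.
  by move=> t tT; have [? ? _] := Heta t tT; exists (eta t); split => //; exact: aeW.
pose a t m w := spart m (eta t w).
have ma t m : (t <= T)%N -> Gmeas (H t) (a t m).
  by move=> tT; have [me _ _] := Heta t tT; exact: Gmeas_spart.
pose Y t w := \sum_m a t m w * U Z t m w.
(* With this density g * a lies in [0, 1] for each direction, so g * Y is a bounded combination of
   the integrable [U Z t m]. *)
pose g t w := damp (\sum_m a t m w).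
have mg t : (t <= T)%N -> Gmeas (H t) (g t).
  move=> tT; apply: (Gmeas_damp (sH tT)); apply: (Gmeas_sum (sH tT)) => m _.
  exact: ma.
have sum_a0 t w : 0 <= \sum_m a t m w by apply: sumr_ge0 => m _; exact: spart_ge0.
have ga01 t m w : 0 <= g t w * a t m w <= 1.
  rewrite mulr_ge0 ?spart_ge0 ?(ltW (damp_gt0 _))//=.
  rewrite (le_trans (ler_wpM2l (ltW (damp_gt0 _)) (_ : _ <= \sum_m a t m w)))//.
    by rewrite (bigD1 m)//= lerDl sumr_ge0// => i _; exact: spart_ge0.
  by rewrite damp_mul// lerBlDr lerDl ltW// damp_gt0.
have gYE t : (fun w => g t w * Y t w) = fun w => \sum_m (g t w * a t m w) * U Z t m w.
  by apply/funext => w; rewrite mulr_sumr; apply: eq_bigr => m _; rewrite mulrA.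
have mga t m : (t <= T)%N -> Gmeas (H t) (fun w => g t w * a t m w).
  by move=> tT; apply: (GmeasM (sH tT)); [exact: mg|exact: ma].
have igaU t m : (t <= T)%N -> intg (fun w => (g t w * a t m w) * U Z t m w).
  move=> tT; apply: (@intgM _ _ _ _ (fun w => g t w * a t m w) _ 1).
  - by apply: (Gmeas_meas (Hm tT)); exact: mga.
  - by move=> w; have /andP[? ?] := ga01 t m w; rewrite ger0_norm.
  - exact: dotv_intg.
have VE : {ae P, forall w, forall t : 'I_T.+1, xi t w = \sum_m a t m w *: fe t m w}.
  apply: filter_forall => t; have tT : (t <= T)%N by rewrite -ltnS.
  have [me _ xe] := Heta t tT.
  by apply: filterS2 xe (F_mx_sum tT (Gmeas_mx_meas tT me)) => w ->.
have SY : {ae P, forall w, \sum_(t < T.+1) Y t w = dotv (Z w) (VT T xi w)}.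
  apply: filterS VE => w VE; rewrite /VT; under [in RHS]eq_bigr do rewrite -[xi _ _]scale1r.
  rewrite dotv_sum; apply: eq_bigr => t _; rewrite mul1r VE dotv_sum.
  by apply: eq_bigr.
have V0 : {ae P, forall w, nonneg_vec (VT T xi w)}.
  apply: filterS3 XV rr' XX' => w XV rr' XX' k.
  have := X'0 w k; have := r'0 w k; rewrite -rr' -XX' XV !mxE; lra.
have Z0' : {ae P, forall w, forall k, 0 < Z w 0 k} by apply: filter_forall => k; exact: Z0.
have SY0 : {ae P, forall w, 0 <= \sum_(t < T.+1) Y t w}.
  apply: filterS3 SY V0 Z0' => w -> Vw Zw; apply: sumr_ge0 => k _.
  by rewrite mulr_ge0// ltW.
have := @generalized_supermartingale_eq0 _ _ _ P H T g Y sH Hm Hf mg _ _ _ SY0.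
move=> /(_ _ _ _)/wrap[|||].
- by move=> t w tT; rewrite damp_gt0 damp_le1.
- by move=> t tT; rewrite gYE; apply: intg_sum => m _; exact: igaU.
- move=> t h tT mh h01; have s := sH tT.
  pose c m w := h w * (g t w * a t m w).
  have mc m : Gmeas (H t) (c m) by apply: GmeasM => //; exact: mga.
  have c01 m w : 0 <= c m w <= 1.
    have /andP[h0 h1] := h01 w; have /andP[k0 k1] := ga01 t m w.
    by rewrite mulr_ge0// mulr_ile1.
  have cn m w : `|c m w| <= 1 by have /andP[? ?] := c01 m w; rewrite ger0_norm.
  have iU m := dotv_intg m LZ tT.
  have iC m : intg (fun w => c m w * cexp P (H t) (U Z t m) w).
    apply: (@intgM _ _ _ _ (c m) _ 1) => //; first exact: (Gmeas_meas (Hm tT)).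
    exact: (cexp_intg s (Hm tT)).
  rewrite (@eq_Rintegral _ _ _ P setT (fun w => \sum_m c m w * U Z t m w)); last first.
    move=> w _; rewrite (congr1 (fun f => f w) (gYE t)) mulr_sumr.
    by apply: eq_bigr => m _; rewrite mulrA.
  rewrite Ex_sum; last first.
    move=> m _; apply: (@intgM _ _ _ _ (c m) _ 1) => //.
    exact: (Gmeas_meas (Hm tT)).
  (* The bounded coefficients pass through the conditional expectation, and (D1) then gives the
     sign. *)
  under eq_bigr do rewrite -(cexp_mul s (Hm tT) (iU _) (mc _) (c01 _)).
  rewrite -Ex_sum//.
  rewrite -oppr_ge0 -mulN1r -RintegralZl//; last exact: intg_sum.
  apply: Ex_ae_ge0.
    by apply: intg_meas; apply: intgZ; exact: intg_sum.
  have [D1 _] := DZ eta LA t tT.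
  apply: filterS D1 => w; rewrite barFE mulN1r oppr_ge0.
  move=> b0; rewrite (_ : \sum_m _ = h w * g t w * \sum_m a t m w * cexp P (H t) (U Z t m) w).
    rewrite mulr_ge0_le0// mulr_ge0 ?(ltW (damp_gt0 _))//.
    by have /andP[] := h01 w.
  by rewrite mulr_sumr; apply: eq_bigr => m _; rewrite /c; ring.
move=> SYeq0.
have V00 : {ae P, forall w, VT T xi w = 0}.
  apply: filterS3 V0 Z0' (filterI SYeq0 SY) => w Vw Zw [-> S0].
  apply/rowP => k; rewrite mxE; have Zk := Zw k.
  have : dotv (Z w) (VT T xi w) == 0 by rewrite -S0.
  rewrite /dotv psumr_eq0 => [/allP/(_ k)|i _]; last by rewrite mulr_ge0// ltW.
  by rewrite mem_index_enum => /(_ isT) /=; rewrite mulf_eq0 gt_eqF//= => /eqP.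
apply: filterS3 rr' XX' (filterI XV V00) => w rr' XX' [XV' Vw].
apply/rowP => k; have := X'0 w k; have := r'0 w k.
by rewrite -rr' -XX' XV' Vw !mxE; lra.
Qed.

(** * Reversible directions, and strategies with signed coefficients *)

Let inA (m : sidx) : bool := `[< Acone (unit_mx m) >].

(** Vanishes where the direction is antisymmetric, an event not in H_t. The zero set of its
    conditional expectation is, up to null sets, the largest event of H_t contained in it. *)
Let dev t m w : R := \sum_k `|fe t m w 0 k + fe t (flip m) w 0 k|.

(* The set of scenarios where the m-th direction can be undone by its opposite
   without loss at time t; directions outside the cone are irrelevant. *)
Let Bset t m : set Omega :=
  if inA m then
    if inA (flip m) then [set w | cexp P (H t) (dev t m) w = 0] else set0
  else setT.

(** Directions outside the cone are kept as zero generators, so the index set depends neither on the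
    cone nor on time. *)
Let fA t m k w : R := if inA m then fe t m w 0 k else 0.

Let uA m : 'M[R]_n := if inA m then unit_mx m else 0.

Let adm t m (mu : Omega -> R) := Gmeas (H t) mu /\ forall w, ~ Bset t m w -> 0 <= mu w.

Lemma dev_intg t m : (t <= T)%N -> intg (dev t m).
Proof.
move=> tT; apply: intg_sum => k _; apply: intg_norm.
by apply: intgD; exact: fe_intg.
Qed.

Lemma Bset_meas t m : (t <= T)%N -> H t (Bset t m).
Proof.
move=> tT; have s := sH tT; rewrite /Bset; case: ifP => _; last exact: GmeasT.
case: ifP => _; last by case: s.
by apply: Gmeas_set_eq; apply: (cexp_meas s (Hm tT)); exact: dev_intg.
Qed.

Lemma Bset_opp t m : (t <= T)%N -> inA m ->
  {ae P, forall w, Bset t m w -> inA (flip m) /\ fe t (flip m) w = - fe t m w}.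
Proof.
move=> tT Am; have s := sH tT; have mT := Hm tT; rewrite /Bset Am.
case: ifP => Af; last by exact: aeW.
have idev := dev_intg m tT.
pose D := [set w | cexp P (H t) (dev t m) w = 0].
have HD : H t D by apply: Gmeas_set_eq; exact: (cexp_meas s mT).
have ED : Ex (fun w => \1_D w * dev t m w) <= 0.
  rewrite -(cexp_indic s mT idev HD) (_ : (fun w => _) = fun=> 0).
    by rewrite Rintegral_cst// mul0r.
  apply/funext => w; rewrite indicE; case: (boolP (w \in D)); last by rewrite mul0r.
  by rewrite inE /D/= => ->; rewrite mulr0.
have D0 : {ae P, forall w, 0 <= \1_D w * dev t m w}.
  by apply: aeW => w; rewrite mulr_ge0 ?indicE// sumr_ge0.
apply: filterS (Ex_ae_eq0 (intg_indic (mT _ HD) idev) D0 ED) => w Ew Dw; split => //.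
move: Ew; rewrite indicE mem_set// mul1r => /eqP; rewrite psumr_eq0// => /allP d0.
apply/rowP => k; rewrite mxE; have := d0 k; rewrite mem_index_enum => /(_ isT)/=.
by rewrite normr_eq0 addrC addr_eq0 => /eqP.
Qed.

Lemma uA_cone m : Acone (uA m).
Proof. by rewrite /uA; case: ifP => // /asboolP. Qed.

(** A negative coefficient occurs only on [Bset], where it stands for a nonnegative multiple of the
    opposite direction. *)
Lemma term_cone t m mu w : adm t m mu -> Acone (mu w *: uA m).
Proof.
move=> [_ mu0]; have [m0|m0] := leP 0 (mu w); first exact: AZ (uA_cone m).
have Bw : Bset t m w by apply: contrapT => /mu0; rewrite leNgt m0.
move: Bw; rewrite /Bset /uA; case: ifP => Am; last by rewrite scaler0.
case: ifP => // Af _; rewrite -[unit_mx m]opprK -unit_mx_flip scalerN -scaleNr.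
by apply: AZ; [rewrite oppr_ge0 ltW|exact/asboolP].
Qed.

Lemma F_term t m mu : (t <= T)%N -> adm t m mu ->
  {ae P, forall w, forall k, F t w (mu w *: uA m) 0 k = mu w * fA t m k w}.
Proof.
move=> tT [_ mu0]; rewrite /uA /fA.
case: ifP => Am; last first.
  by apply: filterS (F_eq0 tT) => w Fw k; rewrite scaler0 Fw mxE mulr0.
apply: filterS2 (F_hom tT) (Bset_opp tT Am) => w hom opp k.
have [m0|m0] := leP 0 (mu w); first by rewrite hom// mxE.
have Bw : Bset t m w by apply: contrapT => /mu0; rewrite leNgt m0.
have [_ E] := opp Bw.
rewrite -[unit_mx m]opprK -unit_mx_flip scalerN -scaleNr hom ?oppr_ge0 ?ltW//.
by rewrite -/(fe t (flip m) w) E !mxE mulrNN.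
Qed.

Let strat (nu : nat -> sidx -> Omega -> R) t w := \sum_m nu t m w *: uA m.

Lemma strat_inN nu t : (t <= T)%N -> (forall m, adm t m (nu t m)) ->
  inN P H Acone F t (Fapp F t (strat nu t)).
Proof.
move=> tT anu; apply/(inNP _ tT); exists (strat nu t); split; last exact: aeW.
  by apply: Gmeas_mx_sum => // m; case: (anu m).
by move=> w; apply: Acone_sum => m _; apply: term_cone (anu m).
Qed.

(** Only an inequality: by superadditivity (HF2) the aggregated position may do better than the sum
    of its parts. *)
Lemma strat_value nu : (forall t m, (t <= T)%N -> adm t m (nu t m)) ->
  {ae P, forall w, forall k, \sum_(t < T.+1) \sum_m nu t m w * fA t m k w <=
    VT T (fun t => Fapp F t (strat nu t)) w 0 k}.
Proof.
move=> anu.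
have : {ae P, forall w, forall (t : 'I_T.+1) k, \sum_m nu t m w * fA t m k w <=
    F t w (strat nu t w) 0 k}.
  apply: filter_forall => t; have tT : (t <= T)%N by rewrite -ltnS.
  have Ft : {ae P, forall w, forall m k, F t w (nu t m w *: uA m) 0 k = nu t m w * fA t m k w}.
    by apply: filter_forall => m; apply: F_term => //; exact: anu.
  apply: filterS2 (F_superadd tT) Ft => w sup Fw k.
  under eq_bigr do rewrite -Fw.
  by apply: sup => m _; apply: (@term_cone t); exact: anu.
apply: filterS => w le k; rewrite /VT summxE; apply: ler_sum => t _; exact: le.
Qed.

Lemma inL0plus_VT xi xi' : inNproc P T H Acone F xi -> inNproc P T H Acone F xi' ->
  {ae P, forall w, forall k, 0 <= VT T xi w 0 k + VT T xi' w 0 k} ->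
  inL0plus P (fun w => VT T xi w + VT T xi' w).
Proof.
have meas (z : nat -> Omega -> 'rV[R]_n) : inNproc P T H Acone F z ->
    exists V : Omega -> 'rV[R]_n, (forall k, measurable_fun setT (fun w => V w 0 k)) /\
      {ae P, forall w, VT T z w = V w}.
  move=> Nz.
  have Hz t : exists z' : Omega -> 'rV[R]_n, (t <= T)%N ->
      (forall k, measurable_fun setT (fun w => z' w 0 k)) /\
      {ae P, forall w, z t w = z' w}.
    have [tT|tT] := leqP t T; last by exists (fun=> 0).
    by have [z' ?] := inN_meas tT (Nz t tT); exists z'.
  have [z' Hz'] := choice Hz.
  exists (fun w => \sum_(t < T.+1) z' t w); split.
    move=> k; rewrite (_ : (fun w => _) = fun w => \sum_(t < T.+1) z' t w 0 k); last first.
      by apply/funext => w; rewrite summxE.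
    apply/GmeasE; apply: (Gmeas_sum (sigma_algebra_measurable Omega)) => t _.
    by apply/GmeasE; case: (Hz' t) => //; rewrite -ltnS.
  have : {ae P, forall w, forall t : 'I_T.+1, z t w = z' t w}.
    by apply: filter_forall => t; case: (Hz' t) => //; rewrite -ltnS.
  by apply: filterS => w E; rewrite /VT; apply: eq_bigr => t _; rewrite E.
move=> /meas[V [mV VE]] /meas[V' [mV' VE']] V0.
exists (fun w => \row_k Num.max (V w 0 k + V' w 0 k) 0); split.
- move=> k; apply/GmeasE; rewrite (_ : (fun w => _) = fun w => Num.max (V w 0 k + V' w 0 k) 0).
    by apply: measurable_maxr => //; exact: measurable_funD.
  by apply/funext => w; rewrite mxE.
- by move=> w k; rewrite mxE le_max lexx orbT.
- apply: filterS3 VE VE' V0 => w <- <- V0; apply/rowP => k.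
  by rewrite !mxE; apply/esym/max_idPl; exact: V0.
Qed.

(** * From KP and HN^0 to an element of D(F) *)

Hypotheses (hN : HN0 P T H Acone F) (hK : KP P T H Acone F).

(** The coefficients are split in two because [KP] places the first process alone in N^0: letting nu
    carry a single generator isolates it. The sum is squeezed between 0 and the total value, which
    [KP] makes 0. *)
Lemma KP_strat nu nu' : (forall t m, (t <= T)%N -> adm t m (nu t m)) ->
  (forall t m, (t <= T)%N -> adm t m (nu' t m)) ->
  (forall k, {ae P, forall w, 0 <= \sum_(t < T.+1) \sum_m (nu t m w + nu' t m w) * fA t m k w}) ->
  (forall t, (t <= T)%N -> inN0 P H Acone F t (Fapp F t (strat nu t))) /\
  (forall k, {ae P, forall w, \sum_(t < T.+1) \sum_m (nu t m w + nu' t m w) * fA t m k w = 0}).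
Proof.
move=> anu anu' S0.
have S0' : {ae P, forall w, forall k, 0 <= \sum_(t < T.+1) \sum_m (nu t m w + nu' t m w) * fA t m k w}.
  exact: filter_forall.
have le : {ae P, forall w, forall k, \sum_(t < T.+1) \sum_m (nu t m w + nu' t m w) * fA t m k w <=
    VT T (fun t => Fapp F t (strat nu t)) w 0 k + VT T (fun t => Fapp F t (strat nu' t)) w 0 k}.
  apply: filterS2 (strat_value anu) (strat_value anu') => w h h' k.
  apply: le_trans (lerD (h k) (h' k)); rewrite -big_split/=; apply: ler_sum => t _.
  by rewrite -big_split/=; apply: ler_sum => m _; rewrite mulrDl.
have Nnu : inNproc P T H Acone F (fun t => Fapp F t (strat nu t)).
  by move=> t tT; apply: strat_inN => // m; exact: anu.
have Nnu' : inNproc P T H Acone F (fun t => Fapp F t (strat nu' t)).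
  by move=> t tT; apply: strat_inN => // m; exact: anu'.
have [|N0 V0] := hK Nnu Nnu'.
  apply: inL0plus_VT => //; apply: filterS2 S0' le => w s0 l k.
  exact: le_trans (s0 k) (l k).
split => [t tT|k]; first exact: N0.
apply: filterS3 S0' le V0 => w s0 l V0.
have := congr1 (fun v : 'rV[R]_n => v 0 k) V0; rewrite mxE [RHS]mxE => Vk.
by apply/eqP; rewrite eq_le s0 andbT (le_trans (l k))// Vk.
Qed.

Let I : finType := ('I_T.+1 * sidx)%type.

Let strat_single t0 m0 (mu : Omega -> R) t w :
  strat (fun t m => if (t == t0) && (m == m0) then mu else fun=> 0) t w =
  if t == t0 then mu w *: uA m0 else 0.
Proof.
rewrite /strat; case: eqP => _ /=; last by rewrite big1// => m _; rewrite scale0r.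
by rewrite (bigD1 m0)//= eqxx big1 ?addr0// => m /negPf ->; rewrite scale0r.
Qed.

Lemma market_nondegenerate (mu : I -> Omega -> R) :
  (forall i, admissible (fun i : I => H i.1) (fun i => Bset i.1 i.2) i (mu i)) ->
  (forall k, {ae P, forall w, 0 <= \sum_i mu i w * fA i.1 i.2 k w}) ->
  (forall k, {ae P, forall w, \sum_i mu i w * fA i.1 i.2 k w = 0}) /\
  (forall i : I, {ae P, forall w, ~ Bset i.1 i.2 w -> mu i w = 0}).
Proof.
move=> amu S0.
have adm0 t m : (t <= T)%N -> adm t m (fun=> 0) by move=> tT; split => //; exact: (Gmeas_cst (sH tT)).
have sumE (nu nu' : nat -> sidx -> Omega -> R) w k :
    (forall (t : 'I_T.+1) m, nu t m w + nu' t m w = mu (t, m) w) ->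
    \sum_(t < T.+1) \sum_m (nu t m w + nu' t m w) * fA t m k w =
    \sum_i mu i w * fA i.1 i.2 k w.
  move=> E; rewrite pair_bigA; apply: eq_bigr => -[t m] _ /=.
  by rewrite E.
pose nu t m := mu (inord t, m).
have anu t m : (t <= T)%N -> adm t m (nu t m).
  by move=> tT; have := amu (inord t, m); rewrite /admissible /= inordK// ltnS.
split.
  have [||_ H0 k] := @KP_strat nu (fun _ _ _ => 0) anu; first by move=> t m; exact: adm0.
    move=> k; apply: filterS (S0 k) => w; rewrite -(sumE nu (fun _ _ _ => 0))// => t m.
    by rewrite /nu inord_val addr0.
  apply: filterS (H0 k) => w; rewrite -(sumE nu (fun _ _ _ => 0))// => t m.
  by rewrite /nu inord_val addr0.
move=> [t0 m0]/=; have t0T : (t0 <= T)%N by rewrite -ltnS.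
set B := Bset t0 m0; set c := mu (t0, m0).
have [mc c0] : adm t0 m0 c by exact: amu (t0, m0).
have [Am|/negP nAm] := boolP (inA m0); last first.
  by apply: aeW => w; rewrite /B /Bset; case: ifP => [/nAm//|_ /(_ Logic.I)].
pose nu1 t m := if (t == t0 :> nat) && (m == m0) then c else fun=> 0.
pose nu2 t m := if (t == t0 :> nat) && (m == m0) then fun=> 0 else nu t m.
have [|||/(_ _ t0T) N0 _] := @KP_strat nu1 nu2.
- move=> t m tT; rewrite /nu1; case: ifP => [/andP[/eqP -> /eqP ->]|_]; last exact: adm0.
  by split.
- by move=> t m tT; rewrite /nu2; case: ifP => _; [exact: adm0|exact: anu].
- move=> k; apply: filterS (S0 k) => w; rewrite -(sumE nu1 nu2)// => t m.
  rewrite /nu1 /nu2; case: ifP => [/andP[/eqP/val_inj -> /eqP ->]|_]; first by rewrite addr0.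
  by rewrite add0r /nu inord_val.
have sE : strat nu1 t0 = fun w => c w *: unit_mx m0.
  by apply/funext => w; rewrite strat_single eqxx /uA Am.
rewrite sE in N0.
have LA : L0A P H Acone t0 (fun w => c w *: unit_mx m0).
  rewrite -sE; exists (strat nu1 t0); split; last exact: aeW.
    apply: Gmeas_mx_sum => // m; rewrite /nu1 eqxx /=; case: ifP => _ //.
    exact: (Gmeas_cst (sH t0T)).
  by move=> w; rewrite sE; have := @term_cone t0 m0 c w (conj mc c0); rewrite /uA Am.
have [opp [eta' [_ Aeta' etaE]]] := hN t0T LA N0.
have s := sH t0T; have mT := Hm t0T.
have idev := dev_intg m0 t0T.
(* The event where the generator is used off B. [HN0] and division by c make the direction
   reversible there, so [dev] and its conditional expectation vanish on D; this contradicts D being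
   disjoint from B unless D is null. *)
pose D := [set w | 0 < c w] `&` ~` B.
have HD : H t0 D.
  apply: GmeasI => //; first by apply: Gmeas_set_lt => //; exact: Gmeas_cst.
  by apply: GmeasC => //; exact: Bset_meas.
have flipA : {ae P, forall w, D w -> inA (flip m0) /\ dev t0 m0 w = 0}.
  apply: filterS3 opp etaE (F_hom t0T) => w; rewrite /Fapp => opp etaE hom [/= cw _].
  split.
    apply/asboolP; rewrite unit_mx_flip.
    rewrite -[- _](@scalerK _ _ (c w)) ?gt_eqF// scalerN etaE.
    by apply: AZ => //; rewrite invr_ge0 ltW.
  have : F t0 w (c w *: - unit_mx m0) = - F t0 w (c w *: unit_mx m0).
    by rewrite scalerN.
  rewrite !hom ?ltW// -scalerN => /(scalerI (lt0r_neq0 cw)) E.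
  rewrite /dev big1// => k _; rewrite /fe unit_mx_flip E.
  by rewrite mxE addrN normr0.
have D0 : {ae P, forall w, D w -> cexp P (H t0) (dev t0 m0) w = 0}.
  apply: (cexp_eq0_on s mT idev) => //; first by move=> w; exact: sumr_ge0.
  by apply: filterS flipA => w fl /fl[].
apply: filterS2 flipA D0 => w fl d0 Bw.
have := c0 w Bw; rewrite le_eqVlt => /orP[/eqP//|cw].
have Dw : D w by [].
have [Af _] := fl Dw; exfalso; apply: Bw.
by rewrite /B /Bset Am Af; exact: d0.
Qed.

Let ae_and (A B : Omega -> Prop) : {ae P, forall w, A w} -> {ae P, forall w, B w} ->
  {ae P, forall w, A w /\ B w}.
Proof. by move=> hA' hB; apply: filterS2 hA' hB. Qed.

(** Increasing time puts the earliest generators at the head, hence outermost in [gcone]. *)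
Let gens : seq I := sort (fun i j : I => (i.1 <= j.1)%N) (enum I).

Lemma gens_pairwise : pairwise (fun i j : I => `[< H i.1 `<=` H j.1 >]) gens.
Proof.
have tot : total (fun i j : I => (i.1 <= j.1)%N) by move=> i j; exact: leq_total.
have tr : transitive (fun i j : I => (i.1 <= j.1)%N) by move=> i j k; exact: leq_trans.
have := sort_sorted tot (enum I); rewrite sorted_pairwise//.
by apply: sub_pairwise => i j ij; apply/asboolP; apply: Hf => //; rewrite -ltnS.
Qed.

Theorem exists_inD : exists Z, inD P T H Acone F Z.
Proof.
pose G' (i : I) := H i.1; pose B' (i : I) := Bset i.1 i.2.
pose f' (i : I) k w := fA i.1 i.2 k w.
have leT (t : 'I_T.+1) : (t <= T)%N by rewrite -ltnS.
have f'i i k : intg (f' i k).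
  by rewrite /f' /fA; case: (inA i.2); [exact: fe_intg|exact: intg_cst].
have mem_gens i : i \in gens by rewrite mem_sort mem_enum.
have [z [zeta [mz z1 mzeta zeta1 dual]]] := @strict_dual_variable _ _ _ P n I G' f' B'
  (fun i => sH (leT i.1)) (fun i => Hm (leT i.1)) (fun i => Bset_meas i.2 (leT i.1)) f'i
  market_nondegenerate gens mem_gens gens_pairwise.
pose Z w : 'rV[R]_n := \row_k z k w.
have ZE k : (fun w => Z w 0 k) = z k by apply/funext => w; rewrite mxE.
have LZ : inLinf P Z.
  split; first by move=> k; rewrite ZE; apply/GmeasE; exact: mz.
  exists 1; apply: aeW => w k; rewrite mxE.
  by have /andP[? ?] := z1 k w; rewrite gtr0_norm.
exists Z; split => //.
  by move=> k; apply: aeW => w; rewrite mxE; have /andP[] := z1 k w.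
move=> eta Leta t tT; have [eta' [me Ae ee]] := Leta t tT.
have s := sH tT; have mT := Hm tT.
have tI : (inord t : 'I_T.+1) = t :> nat by rewrite inordK// ltnS.
pose c m := cexp P (H t) (U Z t m).
have iU m : intg (U Z t m) by exact: dotv_intg.
have mc m : Gmeas (H t) (c m) by exact: (cexp_meas s mT).
have dualm m D : inA m -> H t D ->
    Ex (fun w => \1_D w * U Z t m w) +
    Ex (fun w => \1_D w * (zeta (inord t, m) w * \1_(~` Bset t m) w)) <= 0.
  move=> Am HD; have := dual (inord t, m) D; rewrite /G' /B' /f' /fA /= tI Am => /(_ HD).
  congr (_ + _ <= _); apply: eq_Rintegral => w _; congr (_ * _).
  by apply: eq_bigr => k _; rewrite mxE.
have zB0 m w : 0 <= zeta (inord t, m) w * \1_(~` Bset t m) w.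
  by have /andP[/ltW ? _] := zeta1 (inord t, m) w; rewrite mulr_ge0// indicE.
have iz m : intg (fun w => zeta (inord t, m) w * \1_(~` Bset t m) w).
  have mB : measurable (~` Bset t m) by apply: mT; apply: GmeasC => //; exact: Bset_meas.
  apply: (@intgM _ _ _ _ (zeta (inord t, m)) _ 1) => //.
    by move=> w; have /andP[? ?] := zeta1 (inord t, m) w; rewrite gtr0_norm.
  exact: integrable_indic.
have c_le0 : {ae P, forall w m, c m w <= 0}.
  apply: filter_forall => m; apply: (Gmeas_ae_le0 s mT) => //; first exact: (cexp_intg s mT).
  move=> D HD; rewrite (cexp_indic s mT)//.
  have [Am|/negP nAm] := boolP (inA m).
    apply: le_trans (dualm m D Am HD); rewrite lerDl; apply: Rintegral_ge0 => w _.
    by rewrite mulr_ge0// indicE.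
  rewrite (@Ex_ae_eq _ _ _ P _ (fun=> 0))//; first by rewrite Rintegral_cst// mul0r.
    apply: filterS (fe_out tT (fun h => nAm (asboolT h))) => w fw.
    by rewrite /U fw /dotv big1 ?mulr0// => k _; rewrite !mxE mulr0.
  by apply: intg_meas; apply: intg_indic => //; exact: mT.
(* The origin of (D2): where the conditional price of a direction is 0, strict positivity of zeta
   forces its extra coordinate to vanish, which means that the direction is reversible. *)
have c_eq0 : {ae P, forall w m, inA m -> c m w = 0 -> Bset t m w}.
  apply: filter_forall => m; have [Am|/negP nAm] := boolP (inA m); last exact: aeW.
  pose D := [set w | c m w = 0] `&` ~` Bset t m.
  have HD : H t D.
    apply: GmeasI => //; first exact: Gmeas_set_eq.
    by apply: GmeasC => //; exact: Bset_meas.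
  have E0 : Ex (fun w => \1_D w * (zeta (inord t, m) w * \1_(~` Bset t m) w)) <= 0.
    have := dualm m D Am HD; rewrite -(cexp_indic s mT)// (_ : (fun w => \1_D w * cexp _ _ _ w) = fun=> 0).
      by rewrite Rintegral_cst// mul0r add0r.
    apply/funext => w; rewrite indicE; case: (boolP (w \in D)); last by rewrite mul0r.
    by rewrite inE /D => -[/= cw _]; rewrite -/(c m w) cw mulr0.
  have D0 : {ae P, forall w, 0 <= \1_D w * (zeta (inord t, m) w * \1_(~` Bset t m) w)}.
    by apply: aeW => w; rewrite mulr_ge0// indicE.
  apply: filterS (Ex_ae_eq0 (intg_indic (mT _ HD) (iz m)) D0 E0) => w zw _ cw.
  apply: contrapT => nB; move: zw; rewrite !indicE !mem_set// mul1r mulr1 => z0.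
  by have := zeta1 (inord t, m) w; rewrite z0 ltxx.
have [fe0 opp] : {ae P, forall w m, ~ inA m -> fe t m w = 0} /\
    {ae P, forall w m, inA m -> Bset t m w -> inA (flip m) /\ fe t (flip m) w = - fe t m w}.
  split; apply: filter_forall => m; have [Am|/negP nAm] := boolP (inA m).
  - exact: aeW.
  - by apply: filterS (fe_out tT (fun h => nAm (asboolT h))) => w ->.
  - by apply: filterS (Bset_opp tT Am) => w + _.
  - exact: aeW.
split.
  apply: filterS2 ee c_le0 => w _ cle; rewrite barFE; apply: sumr_le0 => m _.
  by apply: mulr_ge0_le0; [exact: spart_ge0|exact: cle].
(* The event {barF = 0} up to a null set, written with the version eta' so that it belongs to
   H_t. *)
pose C := [set w | \sum_m spart m (eta' w) * c m w = 0].
have HC : H t C.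
  apply: Gmeas_set_eq; apply: (Gmeas_sum s) => m _; apply: GmeasM => //; exact: Gmeas_spart.
(* The test on [inA] makes [eta2] A-valued at every point, not only a.e. *)
pose kap m w := \1_C w * (\1_(Bset t m) w * (if inA m && inA (flip m) then spart m (eta' w) else 0)).
have mkap m : Gmeas (H t) (kap m).
  apply: GmeasM => //; first exact: Gmeas_indic.
  apply: GmeasM => //; first by apply: Gmeas_indic => //; exact: Bset_meas.
  by case: (inA m && _); [exact: Gmeas_spart|exact: Gmeas_cst].
have kap0 m w : 0 <= kap m w.
  by rewrite /kap mulr_ge0 ?indicE// mulr_ge0//; case: ifP => // _; exact: spart_ge0.
(* The process undoing F_t(eta) on C: each direction is replaced by its opposite. *)
pose eta2 (w : Omega) : 'M[R]_n := \sum_m kap (flip m) w *: unit_mx m.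
have me2 : Gmeas_mx (H t) eta2 by apply: Gmeas_mx_sum => // m; exact: mkap.
have key : {ae P, forall w, F t w (eta2 w) =
    - (if barF P H F t (eta t) Z w == 0 then F t w (eta t w) else 0)}.
  have F2 := F_mx_sum tT (Gmeas_mx_meas tT me2).
  have F1 := F_mx_sum tT (Gmeas_mx_meas tT me).
  have {F1 F2}F12 := ae_and F1 F2.
  have {c_le0 c_eq0}cc := ae_and c_le0 c_eq0.
  have {fe0 opp}ff := ae_and fe0 opp.
  have {ff ee}ffe := ae_and ff ee.
  apply: filterS3 F12 cc ffe => w [F1 F2] [cle ceq] [[fe0 opp] E].
  (* Exchanging directions with their opposites preserves disjointness, so these coefficients are
     the positive and negative parts of [eta2]. *)
  have sp m : spart m (eta2 w) = kap (flip m) w.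
    apply: (spart_sum_unit_mx (c := fun m => kap (flip m) w)) => [m'|]; first exact: kap0.
    rewrite flipK /kap; have [E0|E0] := spart_flip m (eta' w).
      by right; rewrite E0 if_same !mulr0.
    by left; rewrite E0 if_same !mulr0.
  rewrite barFE E F1 F2; under eq_bigr do rewrite sp.
  rewrite (reindex_inj (inv_inj (@flipK n))) /=; under eq_bigr do rewrite flipK.
  rewrite -/(c _) /kap indicE.
  case: (boolP (w \in C)); rewrite ?notin_setE ?inE /C/= => Cw; last first.
    rewrite (negbTE (introN eqP Cw)) oppr0 big1// => m _.
    by rewrite mul0r scale0r.
  rewrite Cw eqxx -sumrN; apply: eq_bigr => m _; rewrite mul1r.
  have [Am|/negP nAm] := boolP (inA m); last by rewrite (fe0 m)//= mulr0 scale0r scaler0 oppr0.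
  have [Bw|nB] := pselect (Bset t m w).
    have [Af ->] := opp m Am Bw.
    by rewrite Af indicE mem_set// mul1r scalerN.
  have sc : spart m (eta' w) * c m w = 0.
    have : \sum_m' - (spart m' (eta' w) * c m' w) == 0 by rewrite sumrN Cw oppr0.
    rewrite psumr_eq0 => [/allP/(_ m)|m' _].
      by rewrite mem_index_enum oppr_eq0 => /(_ isT)/eqP.
    by rewrite oppr_ge0; apply: mulr_ge0_le0; [exact: spart_ge0|exact: cle].
  have s0 : spart m (eta' w) = 0.
    move/eqP: sc; rewrite mulf_eq0 => /orP[/eqP//|/eqP cm].
    by have := ceq m Am cm.
  by rewrite s0 if_same mulr0 !scale0r oppr0.
split.
  apply/(inNP _ tT); exists (fun w => \1_C w *: eta' w); split.
  - move=> i j; rewrite [X in Gmeas _ X](_ : _ = fun w => \1_C w * eta' w i j).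
      by apply: GmeasM => //; exact: Gmeas_indic.
    by apply/funext => w; rewrite mxE.
  - by move=> w; apply: AZ => //; rewrite indicE.
  - apply: filterS2 ee (F_eq0 tT) => w E F0.
    rewrite barFE E -/(c _) indicE.
    case: (boolP (w \in C)); rewrite ?notin_setE ?inE /C/=.
      by move=> ->; rewrite eqxx scale1r.
    by move=> /eqP/negPf ->; rewrite scale0r F0.
apply/(inNP _ tT); exists eta2; split => //; last by apply: filterS key.
move=> w; apply: Acone_sum => m _.
rewrite /kap flipK; case: ifP => [/andP[_ Am]|_]; last by rewrite !mulr0 scale0r.
apply: AZ; last exact/asboolP.
by rewrite mulr_ge0 ?indicE// mulr_ge0// spart_ge0.
Qed.

End market.

Theorem mainTheorem2 (R : realType) (dd : measure_display) (Omega : measurableType dd)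
  (P : probability Omega R) (T n : nat) (H : nat -> set (set Omega))
  (Acone : set 'M[R]_n) (F : nat -> Omega -> 'M[R]_n -> 'rV[R]_n) :
  (* complete probability space, d >= 1 *)
  measure_is_complete P -> (0 < n)%N ->
  (* H is a filtration with H_T included in the sigma-algebra of Omega *)
  (forall t, (t <= T)%N -> sigma_algebra setT (H t)) ->
  (forall t, (t <= T)%N -> H t `<=` measurable) ->
  (forall s t, (s <= t)%N -> (t <= T)%N -> H s `<=` H t) ->
  (* A is a closed convex cone *)
  closed Acone -> Acone 0 ->
  (forall a b, Acone a -> Acone b -> Acone (a + b)) ->
  (forall (l : R) a, 0 <= l -> Acone a -> Acone (l *: a)) ->
  (* F in bold-F, H_A and (I) *)
  inBoldF P T Acone F -> HA P T Acone F -> condI P T F ->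
  ((exists Z, inD P T H Acone F Z) -> NAw P T H Acone F) /\
  (HN0 P T H Acone F -> KP P T H Acone F -> NAw P T H Acone F ->
     exists Z, inD P T H Acone F Z).
Proof.
move=> _ _ sH Hm Hf _ A0 AD AZ hF hA hI; split.
  by move=> [Z]; exact: NAw_of_inD.
by move=> hN hK _; exact: exists_inD.
Qed.
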